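(* Let $\{\bar{\mathscr{M}}(t)\}_{t\ge0}$, $\bar{\mathscr{M}}(t)=(\mathscr{M}_1(t),\dots,\mathscr{M}_q(t))$, be the multivariate generalized counting process time-changed by an independent multivariate gamma subordinator, with parameters $q$, $k_i$, $\lambda_{ij_i}$, $\lambda$, $\theta$, $a_i$ as in the context, and let $p_{\bar{\mathscr{M}}}(\bar n,t)=\Pr\{\bar{\mathscr{M}}(t)=\bar n\}$. For $r\in\{1,\dots,q\}$, $l_r\in\{1,\dots,k_r\}$, $\bar n=(n_1,\dots,n_q)\in\mathbb{N}_0^q$ and $t\ge0$ with $p_{\bar{\mathscr{M}}}(\bar n,t)>0$, the hazard rate $$R_{rl_r}(\bar{n};t)=\lim_{h\to 0+}\frac{1}{h}\Pr\Big(\mathscr{M}_r(t+h)=n_r +l_r,\ \bigcap_{k\neq r}\{\mathscr{M}_k(t+h)=n_k\}\ \Big|\ \bigcap_{k=1}^{q}\{\mathscr{M}_k(t)=n_k\} \Big)$$ is given by $$R_{rl_r}(\bar{n};t)=\frac{A(\theta,\bar{a},t)}{p_{\bar{\mathscr{M}}}(\bar{n},t)},$$ where $$\begin{aligned} A(\theta,\bar{a},t)&=(1-\theta)^{\lambda t}\sum_{h_1=0}^{\infty}\sum_{h_2=0}^{\infty}\frac{\lambda\, \theta^{h_1+h_2}}{h_1!\,h_2!}\Big(\prod_{i=1}^{q}a_i^{h_1+h_2+\lambda t}\Big)\\ &\quad\cdot\sum_{\Omega(k_r,l_r)}\ \sum_{\Omega(k_r,n_r)}\Big(\prod_{j_r=1}^{k_r}\frac{\lambda_{rj_r}^{l_{rj_r}}}{l_{rj_r}!}\Big)\Big(\prod_{j_r=1}^{k_r}\frac{\lambda_{rj_r}^{n_{rj_r}}}{n_{rj_r}!}\Big)(a_r+\lambda_r)^{-h_1-h_2-\lambda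 t-\eta_r-\xi_r}\,(h_1+\xi_r-1)!\,(\lambda t)_{h_2+\eta_r}\\ &\quad\cdot\prod_{\substack{i=1\\ i\neq r}}^{q}\ \sum_{\Omega(k_i,n_i)}\Big(\prod_{j_i=1}^{k_i}\frac{\lambda_{ij_i}^{n_{ij_i}}}{n_{ij_i}!}\Big)(a_i+\lambda_i)^{-h_1-h_2-\lambda t-\eta_i}\,(h_2+\lambda t)_{\eta_i}, \end{aligned}$$ with $\xi_r=\sum_{j_r=1}^{k_r}l_{rj_r}$, $\lambda_i=\sum_{j_i=1}^{k_i}\lambda_{ij_i}$ and $\eta_i=\sum_{j_i=1}^{k_i}n_{ij_i}$.
   Context: Multivariate GCP: let $q\in\mathbb{N}$, $k_1,\dots,k_q\in\mathbb{N}$ and $\lambda_{ij_i}>0$ for $1\le i\le q$, $1\le j_i\le k_i$. $\bar M(t)=(M_1(t),\dots,M_q(t))$ has independent components, where $\{M_i(t)\}_{t\ge0}$ is a generalized counting process (GCP): the Lévy process started at $0$ performing independent jumps of sizes $j_i=1,\dots,k_i$ with rates $\lambda_{ij_i}$; equivalently $\Pr\{M_i(t)=n_i\}=\sum_{\Omega(k_i,n_i)}\prod_{j_i=1}^{k_i}\frac{(\lambda_{ij_i}t)^{n_{ij_i}}}{n_{ij_i}!}e^{-\lambda_{ij_i}t}$, $n_i\ge0$. Multivariate gamma subordinator: let $\lambda>0$, $0<\theta<1$, $\bar a=(a_1,\dots,a_q)$ with $a_i>0$. $\{Z_i(t)\}_{t\ge0}$ are gamma Lévy processes with $Z_i(t)\sim\Gamma(\lambda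 t,a_i)$ (shape $\lambda t$, rate $a_i$), $\{B^-(\lambda t)\}_{t\ge0}$ is a negative binomial Lévy process with $\Pr\{B^-(\lambda t)=n\}=(1-\theta)^{\lambda t}\binom{n+\lambda t-1}{n}\theta^n$, $n\ge0$, and $Z_1,\dots,Z_q,B^-$ are mutually independent. $\bar G(t)=(G_1(t),\dots,G_q(t))$ with $G_i(t)=Z_i(t+\lambda^{-1}B^-(\lambda t))$; $\{\bar G(t)\}$ is a Lévy process (multivariate subordinator). Time-changed process: $\{\bar M(t)\}$ and $\{\bar G(t)\}$ are independent and $\mathscr{M}_i(t)=M_i(G_i(t))$. Notation: $\mathbb{N}_0=\{0,1,2,\dots\}$; $\Omega(k_i,n_i)=\{(n_{i1},\dots,n_{ik_i})\in\mathbb{N}_0^{k_i}:\sum_{j_i=1}^{k_i}j_in_{ij_i}=n_i\}$ and $\Omega(k_r,l_r)=\{(l_{r1},\dots,l_{rk_r})\in\mathbb{N}_0^{k_r}:\sum_{j_r=1}^{k_r}j_rl_{rj_r}=l_r\}$; sums over these sets run over the tuples (so $\eta_i$, $\xi_r$ depend on the tuples); $(x)_0=1$, $(x)_k=x(x+1)\cdots(x+k-1)$ for $k\ge1$. *)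

(* Defs.v *)
From HB Require Import structures.
From mathcomp Require Import all_boot all_order all_algebra.
From mathcomp Require Import all_classical all_reals all_analysis.
Set Implicit Arguments.
Unset Strict Implicit.
Unset Printing Implicit Defensive.
Import Order.TTheory GRing.Theory Num.Theory.
Import numFieldNormedType.Exports.
Local Open Scope classical_set_scope.
Local Open Scope ring_scope.

(* A stochastic process on [0, +oo[ is a function X : R -> T -> R of the time
   and of the outcome; its values at negative times are never constrained. *)

Section independence.
Context {R : realType} {d : measure_display} {T : measurableType d}.
Variable P : probability T R.

(* Each F i is meant to contain setT, so that the product rule over the whole
   finite family I implies the product rule over its subfamilies. *)
Definition mutually_independent (I : finType) (F : I -> set_system T) : Prop :=
  forall E : I -> set T, (forall i, F i (E i)) ->
    (P (\bigcap_i E i) = \prod_i P (E i))%E.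

Definition independent (F G : set_system T) : Prop :=
  forall A B : set T, F A -> G B -> (P (A `&` B) = P A * P B)%E.

Definition sigma_rv (Y : T -> R) : set_system T :=
  preimage_set_system setT Y measurable.

Definition sigma_process (X : R -> T -> R) : set_system T :=
  <<s \bigcup_(t in [set t | 0 <= t]) sigma_rv (X t) >>.

Definition sigma_processes (I : Type) (X : I -> R -> T -> R) : set_system T :=
  <<s \bigcup_i sigma_process (X i) >>.

End independence.

Section levy.
Context {R : realType} {d : measure_display} {T : measurableType d}.
Variable P : probability T R.

(* Path regularity is required for every outcome, not just almost surely: the
   processes are evaluated at random times, and this is what makes the resulting
   functions measurable even if P is not complete. *)
Record levy_process (X : R -> T -> R) : Prop := LevyProcess {
  levy_measurable : forall t, 0 <= t -> measurable_fun setT (X t);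
  levy_start : {ae P, forall w, X 0 w = 0};
  levy_independent_increments : forall (m : nat) (s : nat -> R),
    0 <= s 0%N -> {homo s : i j / (i <= j)%N >-> i <= j} ->
    mutually_independent P
      (fun i : 'I_m => sigma_rv (fun w => X (s i.+1) w - X (s i) w));
  levy_stationary_increments : forall (s h : R) (A : set R),
    0 <= s -> 0 <= h -> measurable A ->
    P [set w | A (X (s + h) w - X s w)] = P [set w | A (X h w)];
  levy_stochastically_continuous : forall t e : R, 0 <= t -> 0 < e ->
    P [set w | e < `|X s w - X t w|]
      @[s --> within [set s | 0 <= s] (nbhs t)] --> (0 : \bar R);
  levy_right_continuous : forall w t, 0 <= t -> X s w @[s --> t^'+] --> X t w;
  levy_left_limits : forall w t, 0 < t -> cvg (X s w @[s --> t^'-])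
}.

(* Nonnegativity for every outcome keeps random times in [0, +oo[; together with
   stationary increments it makes the paths almost surely nondecreasing. *)
Definition subordinator (X : R -> T -> R) : Prop :=
  levy_process X /\ forall t w, 0 <= t -> 0 <= X t w.

End levy.

(* The tuples of N_0^k whose entries, weighted by 1, ..., k, sum to n.  All
   these weights are positive, so the entries are at most n and the tuples fit
   in a finite type; the ordinal j stands for the jump size j.+1. *)
Definition Omega (k n : nat) : {set {ffun 'I_k -> 'I_n.+1}} :=
  [set m : {ffun 'I_k -> 'I_n.+1} | (\sum_(j < k) j.+1 * m j)%N == n]%SET.

Definition tuple_sum (k n : nat) (m : {ffun 'I_k -> 'I_n.+1}) : nat :=
  (\sum_(j < k) m j)%N.

Definition rising {R : realType} (x : R) (n : nat) : R :=
  \prod_(i < n) (x + i%:R).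

Definition gbinom {R : realType} (x : R) (n : nat) : R :=
  (\prod_(i < n) (x - i%:R)) / n`!%:R.

Definition gamma_fun {R : realType} (s : R) : R :=
  \int[lebesgue_measure]_(x in `]0, +oo[) (x `^ (s - 1) * expR (- x)).

Definition gamma_pdf {R : realType} (s a x : R) : R :=
  if 0 < x then a `^ s * x `^ (s - 1) * expR (- (a * x)) / gamma_fun s else 0.

Section processes.
Context {R : realType} {d : measure_display} {T : measurableType d}.
Variable P : probability T R.

Definition gcp (k : nat) (rate : 'I_k -> R) (M : R -> T -> R) : Prop :=
  levy_process P M /\
  forall (t : R) (n : nat), 0 <= t ->
    P [set w | M t w = n%:R] =
    (\sum_(m in Omega k n) \prod_(j < k)
       ((rate j * t) ^+ m j / (m j)`!%:R * expR (- (rate j * t))))%:E.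

(* At t = 0 the law is the Dirac mass at 0, by levy_start. *)
Definition gamma_process (lambda a : R) (Z : R -> T -> R) : Prop :=
  subordinator P Z /\
  forall (t : R) (A : set R), 0 < t -> measurable A ->
    P [set w | A (Z t w)] =
    (\int[lebesgue_measure]_(x in A) (gamma_pdf (lambda * t) a x)%:E)%E.

Definition negative_binomial_process (theta : R) (B : R -> T -> R) : Prop :=
  subordinator P B /\
  forall (s : R) (n : nat), 0 <= s ->
    P [set w | B s w = n%:R] =
    ((1 - theta) `^ s * gbinom (n%:R + s - 1) n * theta ^+ n)%:E.

Definition multivariate_gcp (q : nat) (k : 'I_q -> nat)
    (rate : forall i : 'I_q, 'I_(k i) -> R) (M : 'I_q -> R -> T -> R) : Prop :=
  (forall i, gcp (rate i) (M i)) /\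
  mutually_independent P (fun i => sigma_process (M i)).

(* None is the index of B, Some i that of Z i. *)
Definition gamma_components (q : nat) (lambda theta : R) (a : 'I_q -> R)
    (Z : 'I_q -> R -> T -> R) (B : R -> T -> R) : Prop :=
  [/\ forall i, gamma_process lambda (a i) (Z i),
      negative_binomial_process theta B &
      mutually_independent P (fun o : option 'I_q =>
        if o is Some i then sigma_process (Z i) else sigma_process B)].

Definition gamma_subordinator (q : nat) (lambda : R) (Z : 'I_q -> R -> T -> R)
    (B : R -> T -> R) : 'I_q -> R -> T -> R :=
  fun i t w => Z i (t + lambda^-1 * B (lambda * t) w) w.

Definition time_change (q : nat) (M G : 'I_q -> R -> T -> R) :
    'I_q -> R -> T -> R :=
  fun i t w => M i (G i t w) w.

Definition time_changed_gcp (q : nat) (lambda : R) (M Z : 'I_q -> R -> T -> R)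
    (B : R -> T -> R) : 'I_q -> R -> T -> R :=
  time_change M (gamma_subordinator lambda Z B).

Definition in_state (q : nat) (X : 'I_q -> R -> T -> R) (t : R)
    (n : 'I_q -> nat) : set T :=
  [set w | forall i, X i t w = (n i)%:R].

Definition state_prob (q : nat) (X : 'I_q -> R -> T -> R) (n : 'I_q -> nat) (t : R)
    : R :=
  fine (P (in_state X t n)).

Definition cond_prob (A B : set T) : R := fine (P (A `&` B)) / fine (P B).

Definition jump_state (q : nat) (n : 'I_q -> nat) (r : 'I_q) (l : nat) :
    'I_q -> nat :=
  fun i => if i == r then (n i + l)%N else n i.

Definition hazard_quotient (q : nat) (X : 'I_q -> R -> T -> R)
    (n : 'I_q -> nat) (r : 'I_q) (l : nat) (t h : R) : R :=
  h^-1 * cond_prob (in_state X (t + h) (jump_state n r l)) (in_state X t n).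

End processes.

Section hazard_numerator.
Context {R : realType}.
Variables (q : nat) (k : 'I_q -> nat) (rate : forall i : 'I_q, 'I_(k i) -> R).
Variables (lambda theta : R) (a : 'I_q -> R).

Definition total_rate (i : 'I_q) : R := \sum_(j < k i) rate j.

Definition weight (i : 'I_q) (n : nat) (m : {ffun 'I_(k i) -> 'I_n.+1}) : R :=
  \prod_(j < k i) (rate j ^+ m j / (m j)`!%:R).

(* Omega (k r) l with l > 0 only has tuples of positive sum, so that the
   truncated subtraction in the factorial is a true one. *)
Definition hazard_term (n : 'I_q -> nat) (r : 'I_q) (l : nat) (t : R)
    (h1 h2 : nat) : R :=
  lambda * theta ^+ (h1 + h2) / (h1`!%:R * h2`!%:R)
  * (\prod_(i < q) a i `^ (h1%:R + h2%:R + lambda * t))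
  * (\sum_(y in Omega (k r) l) \sum_(m in Omega (k r) (n r))
       weight y * weight m
       * (a r + total_rate r)
           `^ (- h1%:R - h2%:R - lambda * t - (tuple_sum m)%:R - (tuple_sum y)%:R)
       * (h1 + tuple_sum y - 1)`!%:R
       * rising (lambda * t) (h2 + tuple_sum m))
  * \prod_(i < q | i != r) (\sum_(m in Omega (k i) (n i))
       weight m
       * (a i + total_rate i)
           `^ (- h1%:R - h2%:R - lambda * t - (tuple_sum m)%:R)
       * rising (h2%:R + lambda * t) (tuple_sum m)).

(* Extended-real valued, so that a divergent series is not given a junk real
   value. *)
Definition hazard_numerator (n : 'I_q -> nat) (r : 'I_q) (l : nat) (t : R) :
    \bar R :=
  (((1 - theta) `^ (lambda * t))%:E *
   \sum_(0 <= h1 <oo) \sum_(0 <= h2 <oo) (hazard_term n r l t h1 h2)%:E)%E.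

End hazard_numerator.

(* Main.v *)
From HB Require Import structures.
Require Import Defs.
From mathcomp Require Import all_boot all_order all_algebra.
From mathcomp Require Import all_classical all_reals all_analysis.
From mathcomp Require Import measurable_realfun.
From mathcomp Require Import ring.
Set Implicit Arguments.
Unset Strict Implicit.
Unset Printing Implicit Defensive.
Import Order.TTheory GRing.Theory Num.Theory.
Import numFieldNormedType.Exports.
Local Open Scope classical_set_scope.
Local Open Scope ring_scope.

(* The time-changed process has stationary independent increments, hence
   P(X(t) = n, X(t + h) = n + l e_r) = p(n, t) p(l e_r, h); this is obtained by
   conditioning on the subordinator G and then on the values of B.  Both factors
   are series over the values c of B whose terms involve Gamma mixtures of the
   GCP probabilities.  With rho = theta * prod_i a_i / (a_i + lambda_i), the
   negative binomial series sum_c (x)_c rho^c / c! = (1 - rho)^(- x) puts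
   p(l e_r, h) in closed form, so that p(l e_r, h) / h has a limit as h -> 0
   without any exchange of limit and series, and the same identity sums the
   h_1-series of A: the double series A is p(n, t) times that limit. *)

(** * Gamma integrals and the negative binomial series *)

(** The components share the clock [t + lambda^-1 * B (lambda * t)], so they are dependent, and the
    times at which the [Z i] are read are random. On the event that [B (lambda * t)] is b and that
    [B] then grows by c over a further span [lambda * h], the clock is deterministic: it reads t + b
    / lambda and then advances by h + c / lambda. Since [B] and its increments are almost surely
    integers, countably many such events exhaust the space, and on each of them the independence of
    the [Z i] and [B] applies at fixed times. The integral over such an event is a term in b times a
    term in c, which is why the double series splits. The factor a_i / (a_i + lambda_i) in rho is
    the probability that the i-th GCP makes no jump before an independent exponential time of rate
    a_i: each unit of [B] adds one such exponential time to every G_i. The order h of p(l e_r, h)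
    comes from (lambda h)_xi = lambda h (lambda h + 1)_(xi - 1), where xi >= 1 because l > 0. *)

Definition pushforward_measure {d d'} {T1 : measurableType d}
    {T2 : measurableType d'} {R : realType} (m : measure T1 R) {f : T1 -> T2}
    (mf : measurable_fun setT f) : measure T2 R :=
  measure_function_pushforward__canonical__measure_function_Measure m mf.

Section gamma_integrals.
Context {R : realType}.
Local Notation mu := (@lebesgue_measure R).
Implicit Types (s c x : R) (A : set R).

(** By uniqueness of Lebesgue measure, it is enough that c times the image measure under
    multiplication by c gives half-open intervals their length. *)
Lemma lebesgue_measure_scale c A : 0 < c -> measurable A ->
  mu ( *%R c @^-1` A) = ((c^-1)%:E * mu A)%E.
Proof.
move=> c0 mA.
have mc : measurable_fun setT (fun x : measurableTypeR R => c * x : measurableTypeR R).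
  exact: measurable_funM.
pose nu := mscale (NngNum (ltW c0)) (pushforward_measure mu mc).
suff -> : mu A = nu A.
  rewrite /nu /mscale/= muleA -EFinM mulVf ?mul1e//; exact: lt0r_neq0.
apply: lebesgue_measure_unique => //= _ [[a b]] _ <-.
rewrite /nu /mscale /= /pushforward /=.
rewrite (_ : _ @^-1` _ = `](a / c), (b / c)]%classic); last first.
  apply/seteqP; split => x /=; rewrite !in_itv/= ler_pdivlMr// ltr_pdivrMr//;
    by rewrite mulrC.
rewrite !lebesgue_measure_itv/= !lte_fin ltr_pM2r ?invr_gt0//.
case: ifPn => _; last by rewrite mule0.
rewrite -!EFinB -EFinM; congr EFin; rewrite -mulrBl mulrC divfK//.
exact: lt0r_neq0.
Qed.

Lemma ge0_integral_scale c (f : R -> \bar R) : 0 < c ->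
  measurable_fun setT f -> (forall x, (0 <= f x)%E) ->
  (\int[mu]_x f (c * x)%R = (c^-1)%:E * \int[mu]_x f x)%E.
Proof.
move=> c0 mf f0.
have mc : measurable_fun setT (fun x : measurableTypeR R => c * x : measurableTypeR R).
  exact: measurable_funM.
have c0' : 0 <= c^-1 by rewrite invr_ge0 ltW.
transitivity (\int[pushforward_measure mu mc]_x f x)%E.
  by rewrite ge0_integral_pushforward.
rewrite -[RHS](ge0_integral_mscale mu measurableT (NngNum c0'))//.
apply: (@eq_measure_integral _ _ R setT (mscale (NngNum c0') mu)) => A mA _.
exact: lebesgue_measure_scale.
Qed.


(** For x > 1 the power is compared with one term of the exponential series of x / 2, of degree
    above s; the summand 1 in the constant covers x <= 1. The rate 1/2 leaves a factor exp(- x / 2)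
    to spare against exp(- x). *)
Lemma powR_le_expR s : 0 <= s ->
  exists C : R, 0 < C /\ forall x : R, 0 < x -> x `^ s <= C * expR (x / 2).
Proof.
move=> s0; pose m := Num.truncn s.
have sm : s <= m.+1%:R by rewrite ltW// truncnS_gt.
have C0 : 0 < 2 ^+ m.+1 * m.+1`!%:R :> R.
  by rewrite mulr_gt0// ?exprn_gt0// ltr0n fact_gt0.
exists (1 + 2 ^+ m.+1 * m.+1`!%:R); split; first by rewrite addr_gt0.
move=> x x0; have x20 : 0 <= x / 2 by rewrite divr_ge0// ltW.
have e1 : 1 <= expR (x / 2).
  by rewrite (le_trans _ (expR_ge1Dx _))// lerDl.
have e0 := expR_ge0 (x / 2).
have [x1|x1] := leP x 1.
  apply: (@le_trans _ _ 1); first by rewrite -(powRr0 x) ger_powR// x0.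
  by rewrite (le_trans e1)// ler_peMl// lerDl ltW.
apply: (@le_trans _ _ (x ^+ m.+1)).
  by rewrite -powR_mulrn ?(ltW x0)// ler_powR// ltW.
have := expR_ge1Dxn m x20.
rewrite expr_div_n -mulrA -invfM => h.
have {}h : x ^+ m.+1 / (2 ^+ m.+1 * m.+1`!%:R) <= expR (x / 2).
  by rewrite (le_trans _ h)// lerDr.
rewrite ler_pdivrMr// in h.
by rewrite (le_trans h)// mulrC ler_wpM2r// lerDr.
Qed.

(** The rate c is a parameter because later integrals have rates 1 - x and a + L. Extension by 0 to
    the whole line lets the scaling lemma apply directly. *)
Definition gamma_integrand s c x : R :=
  if 0 < x then x `^ (s - 1) * expR (- (c * x)) else 0.

Definition gamma_integral s c : \bar R :=
  (\int[mu]_x (gamma_integrand s c x)%:E)%E.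

Lemma gamma_integrand_ge0 s c x : 0 <= gamma_integrand s c x.
Proof.
rewrite /gamma_integrand; case: ifP => // _.
by rewrite mulr_ge0 ?powR_ge0 ?expR_ge0.
Qed.

Lemma measurable_gamma_integrand s c : measurable_fun setT (gamma_integrand s c).
Proof.
apply: measurable_fun_ifT => //.
  exact: measurable_fun_ltr.
apply: measurable_funM; first exact: measurable_powR.
by apply: measurableT_comp => //; apply: measurableT_comp => //; exact: measurable_funM.
Qed.

Lemma gamma_integral_ge0 s c : (0 <= gamma_integral s c)%E.
Proof. by apply: integral_ge0 => x _; rewrite lee_fin gamma_integrand_ge0. Qed.

Lemma gamma_integral_scale s c : 0 < c ->
  gamma_integral s c = ((c `^ (- s))%:E * gamma_integral s 1)%E.
Proof.
move=> c0; have cN0 : c != 0 by exact: lt0r_neq0.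
have mg : measurable_fun setT (fun x => (gamma_integrand s 1 x)%:E).
  by apply/measurable_EFinP; exact: measurable_gamma_integrand.
have g0 x : (0 <= (gamma_integrand s 1 x)%:E)%E.
  by rewrite lee_fin gamma_integrand_ge0.
have := ge0_integral_scale c0 mg g0.
under eq_integral => x _.
  rewrite (_ : gamma_integrand s 1 (c * x) = c `^ (s - 1) * gamma_integrand s c x); last first.
    rewrite /gamma_integrand pmulr_rgt0//; case: ifPn => x0; last by rewrite mulr0.
    by rewrite powRM ?ltW// mul1r mulrA.
  rewrite EFinM; over.
rewrite ge0_integralZl//; last first.
- by rewrite lee_fin powR_ge0.
- by move=> x _; rewrite lee_fin gamma_integrand_ge0.
- by apply/measurable_EFinP; exact: measurable_gamma_integrand.
rewrite -/(gamma_integral s c) -/(gamma_integral s 1) => h.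
have -> : c `^ (- s) = (c `^ (s - 1))^-1 * c^-1.
  rewrite -powRN -[in X in _ * X](powR_inv1 (ltW c0)) -powRD ?cN0 ?implybT//.
  by congr (_ `^ _); ring.
rewrite EFinM -muleA -h muleA -EFinM mulVf ?mul1e//.
by rewrite gt_eqF// powR_gt0.
Qed.


(* For s < 1 the integrand is unbounded at 0, so integration by parts is done on
   compact windows exhausting ]0, +oo[. *)
Let window (i : nat) : set R := `[i.+2%:R^-1, i.+2%:R]%classic.

Let window_nondecreasing : nondecreasing_seq window.
Proof.
move=> i j ij; apply/subsetPset => x; rewrite /window/= !in_itv/= => /andP[ix xi].
apply/andP; split; last by rewrite (le_trans xi)// ler_nat !ltnS.
by rewrite (le_trans _ ix)// lef_pV2 ?posrE// ler_nat !ltnS.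
Qed.

Let bigcup_window : \bigcup_i window i = `]0, +oo[%classic.
Proof.
apply/seteqP; rewrite /window; split => x /=.
  move=> [i _] /=; rewrite !in_itv/= andbT => /andP[+ _].
  by apply: lt_le_trans; rewrite invr_gt0.
rewrite in_itv/= andbT => x0.
exists (maxn (Num.truncn x) (Num.truncn x^-1)) => //=.
rewrite in_itv/=; apply/andP; split.
  rewrite invf_ple ?posrE//; apply: (le_trans (ltW (truncnS_gt _))).
  by rewrite ler_nat ltnS leqW// leq_maxr.
apply: (le_trans (ltW (truncnS_gt _))).
by rewrite ler_nat ltnS leqW// leq_maxl.
Qed.

Let gamma_integral_window s c :
  (\int[mu]_(x in window i) (gamma_integrand s c x)%:E)%E @[i --> \oo]
    --> gamma_integral s c.
Proof.
rewrite /gamma_integral.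
rewrite (_ : (\int[mu]_x _ = \int[mu]_(x in \bigcup_i window i) (gamma_integrand s c x)%:E)%E).
  apply: ge0_nondecreasing_set_cvg_integral => //.
  - by move=> i; exact: measurable_itv.
  - move=> i; apply/measurable_EFinP/measurable_funTS.
    exact: measurable_gamma_integrand.
  - by move=> i x _; rewrite lee_fin gamma_integrand_ge0.
rewrite bigcup_window [RHS]integral_mkcond; apply: eq_integral => x _.
rewrite patchE; case: ifPn => //; rewrite notin_setE/= in_itv/= andbT.
by rewrite /gamma_integrand => /negP/negbTE ->.
Qed.

Let window_by_parts s i :
  (\int[mu]_(x in window i) (gamma_integrand (s + 1) 1 x)%:E =
   (i.+2%:R^-1 `^ s * expR (- i.+2%:R^-1) - i.+2%:R `^ s * expR (- i.+2%:R))%:E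
   + s%:E * \int[mu]_(x in window i) (gamma_integrand s 1 x)%:E)%E.
Proof.
set e : R := i.+2%:R^-1; set N : R := i.+2%:R.
have e0 : 0 < e by rewrite invr_gt0.
have eN : e < N.
  rewrite (@lt_trans _ _ 1)// ?invf_lt1// ?ltr1n//.
have pos x : x \in `[e, N] -> 0 < x.
  by rewrite in_itv/= => /andP[+ _]; exact: lt_le_trans.
have poso x : x \in `]e, N[ -> 0 < x.
  by rewrite in_itv/= => /andP[+ _]; exact: lt_trans.
have cpow (p x : R) : 0 < x -> {for x, continuous (fun y : R => y `^ p)}.
  move=> x0; apply: differentiable_continuous; apply/derivable1_diffP.
  by apply: derivable_powR; rewrite in_itv/= x0.
have cexp (x : R) : {for x, continuous (fun x : R => expR (- x))}.
  by apply: continuous_comp; [exact: opp_continuous|exact: continuous_expR].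
have dexp (x : R) : is_derive x 1 (fun x : R => - expR (- x)) (expR (- x)).
  have dN : is_derive x 1 (-%R : R -> R) (-1).
    by apply: (@is_deriveN _ _ _ (@id R)); exact: is_derive_id.
  have := is_deriveN (is_derive1_comp (is_derive_expR (- x)) dN).
  by rewrite mulrN1 opprK.
have main := @integration_by_parts R (fun y => y `^ s) (fun x => - expR (- x))
  (fun x => s * x `^ (s - 1)) (fun x => expR (- x)) e N eN.
transitivity (\int[mu]_(x in window i) (x `^ s * expR (- x))%:E)%E.
  apply: eq_integral => x; rewrite inE => /pos x0.
  by rewrite /gamma_integrand x0 addrK mul1r.
rewrite main; last first.
- by move=> x _; rewrite derive1E; exact: derive_val.
- split; [by move=> x _; exact: ex_derive| |].
  + by apply: cvg_at_right_filter; apply: cvgN; exact: cexp.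
  + by apply: cvg_at_left_filter; apply: cvgN; exact: cexp.
- by apply: continuous_in_subspaceT => x _; exact: cexp.
- by move=> x /poso x0; rewrite powR_derive1// in_itv/= x0.
- split.
  + by move=> x /poso x0; apply: derivable_powR; rewrite in_itv/= x0.
  + by apply: cvg_at_right_filter; exact: cpow.
  + by apply: cvg_at_left_filter; apply: cpow; exact: lt_trans eN.
- apply: continuous_in_subspaceT => x /set_mem/pos x0.
  by apply: cvgM; [exact: cvg_cst|exact: cpow].
have -> : (\int[mu]_(x in window i) (s * x `^ (s - 1) * - expR (- x))%:E
   = - (s%:E * \int[mu]_(x in window i) (gamma_integrand s 1 x)%:E))%E.
  transitivity (\int[mu]_(x in window i) ((- s)%:E * (x `^ (s - 1) * expR (- x))%:E))%E.
    by apply: eq_integral => x _; rewrite -EFinM; congr EFin; ring.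
  rewrite integralZl//; [|exact: measurable_itv|].
    rewrite EFinN mulNe; congr (- (_ * _))%E; apply: eq_integral => x.
    by rewrite inE => /pos x0; rewrite /gamma_integrand x0 mul1r.
  apply: continuous_compact_integrable; first exact: segment_compact.
  apply: continuous_in_subspaceT => x /set_mem/pos x0.
  by apply: cvgM; [exact: cpow|exact: cexp].
by rewrite oppeK; congr (_ + _)%E; congr EFin; ring.
Qed.

Let window_boundary s : 0 < s ->
  (i.+2%:R^-1 `^ s * expR (- i.+2%:R^-1) - i.+2%:R `^ s * expR (- i.+2%:R)) @[i --> \oo]
  --> (0 : R).
Proof.
(* The bound is taken at exponent s + 1: the extra power of the upper end N = i + 2 bounds the
   boundary term there by C / N. At the lower end 1 / N the power s > 0 alone tends to 0. *)
move=> s0; have [C [C0 hC]] := powR_le_expR (addr_ge0 (ltW s0) ler01).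
have e0 i : 0 < i.+2%:R^-1 :> R by rewrite invr_gt0.
have ecvg : i.+2%:R^-1 @[i --> \oo] --> (0 : R).
  by have := @cvg_harmonic R; rewrite -cvg_shiftS.
rewrite -[X in _ --> X]subr0; apply: cvgB.
  apply: (@squeeze_cvgr _ _ _ _ (fun=> 0) (fun i => i.+2%:R^-1 `^ s)).
  - near=> i; rewrite mulr_ge0 ?powR_ge0 ?expR_ge0//=.
    by rewrite ler_piMr ?powR_ge0// expR_le1 oppr_le0 ltW.
  - exact: cvg_cst.
  - exact: (cvg_at_rightP (fun a => a `^ s) 0 0).1 (powR_cvg0 s0) _ (conj e0 ecvg).
apply: (@squeeze_cvgr _ _ _ _ (fun=> 0) (fun i => C * i.+2%:R^-1)).
- near=> i; rewrite mulr_ge0 ?powR_ge0 ?expR_ge0//=.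
  rewrite ler_pdivlMr// mulrAC.
  have -> : i.+2%:R `^ s * i.+2%:R = i.+2%:R `^ (s + 1) :> R.
    by rewrite powRD ?pnatr_eq0 ?implybT// powRr1.
  rewrite expRN ler_pdivrMr ?expR_gt0//.
  apply: (le_trans (hC _ _)); first by [].
  by rewrite ler_pM2l// ler_expR ler_pdivrMr// ler_peMr// ler1n.
- exact: cvg_cst.
- by rewrite -(mulr0 C); apply: cvgM => //; exact: cvg_cst.
Unshelve. all: by end_near. Qed.

Lemma gamma_integralD1 s : 0 < s ->
  gamma_integral (s + 1) 1 = (s%:E * gamma_integral s 1)%E.
Proof.
move=> s0; rewrite -[RHS]add0e.
rewrite -(cvg_lim _ (@gamma_integral_window (s + 1) 1))//; apply/cvg_lim => //.
under eq_fun do rewrite window_by_parts.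
apply: cvgeD.
- by rewrite fin_num_adde_defr.
- by apply: cvg_EFin; [exact: nearW|exact: window_boundary].
- exact: cvgeZl (@gamma_integral_window s 1).
Qed.

(** With s - 1 >= 0 there is no singularity at 0, and the integrand is dominated by a multiple of
    the exponential density of rate 1/2; the factor 2 undoes its normalisation. *)
Let gamma_integral_ltey_ge1 s : 1 <= s -> (gamma_integral s 1 < +oo)%E.
Proof.
move=> s1; have [C [C0 hC]] := @powR_le_expR (s - 1) ltac:(by rewrite subr_ge0).
have half0 : 0 < 2^-1 :> R by rewrite invr_gt0.
have mexp : measurable_fun setT (fun x => (exponential_pdf (2^-1 : R) x)%:E).
  by apply/measurable_EFinP; exact: measurable_exponential_pdf.
have key (x : R) : gamma_integrand s 1 x <= 2 * C * exponential_pdf 2^-1 x.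
  rewrite /gamma_integrand; case: ifPn => x0; last first.
    by rewrite mulr_ge0 ?exponential_pdf_ge0// ?ltW// mulr_gt0.
  rewrite exponential_pdfE ?(ltW x0)//.
  apply: (@le_trans _ _ (C * expR (x / 2) * expR (- (1 * x)))).
    by rewrite ler_wpM2r ?expR_ge0// hC.
  rewrite -mulrA -expRD mulrCA !mulrA mulVf// !mul1r.
  by rewrite (_ : x / 2 - x = - 2^-1 * x) ?lexx//; field.
apply: (@le_lt_trans _ _ (\int[mu]_x ((2 * C)%:E * (exponential_pdf 2^-1 x)%:E))%E).
  apply: ge0_le_integral => //.
  - by move=> x _; rewrite lee_fin gamma_integrand_ge0.
  - by apply/measurable_EFinP; exact: measurable_gamma_integrand.
  - exact: measurable_funeM.
  by move=> x _; rewrite -EFinM lee_fin key.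
rewrite ge0_integralZl//; last first.
- by rewrite lee_fin mulr_ge0// ltW.
- by move=> x _; rewrite lee_fin exponential_pdf_ge0// ltW.
by rewrite integral_exponential_pdf// mule1 ltry.
Qed.

(** For s < 1 finiteness descends from s + 1 through the functional equation: an infinite value at s
    would be infinite at s + 1 too. *)
Lemma gamma_integral_ltey s : 0 < s -> (gamma_integral s 1 < +oo)%E.
Proof.
move=> s0; have := @gamma_integral_ltey_ge1 (s + 1) ltac:(by rewrite lerDr ltW).
rewrite gamma_integralD1// !ltey; apply: contra => /eqP ->.
by rewrite gt0_muley ?lte_fin.
Qed.

(** A zero integral would make the integrand vanish almost everywhere, whereas it is positive on
    [1, 2]. *)
Lemma gamma_integral_gt0 s : (0 < gamma_integral s 1)%E.
Proof.
rewrite lt_def gamma_integral_ge0 andbT; apply/eqP => g0.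
have mg : measurable_fun setT (fun x => (gamma_integrand s 1 x)%:E).
  by apply/measurable_EFinP; exact: measurable_gamma_integrand.
have : mu [set` `[1%R, 2%R : R]] = 0%E.
  apply: measure_negligible; first exact: measurable_itv.
  apply: negligibleS ((ae_eq_integral_abs mu measurableT mg).1 _).
    move=> x /=; rewrite in_itv/= => /andP[x1 _] /(_ I) /eqP.
    rewrite /gamma_integrand (lt_le_trans ltr01 x1) eqe mulf_eq0.
    by rewrite gt_eqF ?gt_eqF ?expR_gt0 ?powR_gt0// (lt_le_trans ltr01 x1).
  rewrite -[RHS]g0; apply: eq_integral => x _.
  by rewrite gee0_abs// lee_fin gamma_integrand_ge0.
rewrite lebesgue_measure_itv/= lte_fin ltr1n => /eqP.
by rewrite -EFinB eqe subr_eq0 gt_eqF ?ltr1n.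
Qed.

Lemma gamma_integralE s : 0 < s -> gamma_integral s 1 = (gamma_fun s)%:E.
Proof.
move=> s0.
have : gamma_fun s = fine (gamma_integral s 1).
  rewrite /gamma_fun /Rintegral [in LHS]integral_mkcond; congr fine.
  apply: eq_integral => x _; rewrite patchE /gamma_integrand.
  rewrite mem_setE in_itv/= andbT; case: ifP => // _; by rewrite mul1r.
by move=> ->; rewrite fineK// ge0_fin_numE ?gamma_integral_ltey// gamma_integral_ge0.
Qed.

Lemma gamma_fun_gt0 s : 0 < s -> 0 < gamma_fun s.
Proof. by move=> s0; rewrite -lte_fin -gamma_integralE// gamma_integral_gt0. Qed.

Lemma gamma_funD_nat s n : 0 < s -> gamma_fun (s + n%:R) = rising s n * gamma_fun s.
Proof.
move=> s0; elim: n => [|n IH]; first by rewrite addr0 /rising big_ord0 mul1r.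
have sn0 : 0 < s + n%:R by rewrite ltr_wpDr.
have sn1 : 0 < s + n%:R + 1 by rewrite addr_gt0.
apply: EFin_inj; rewrite -natr1 addrA -gamma_integralE//.
rewrite gamma_integralD1// gamma_integralE// -EFinM IH /rising big_ord_recr/=.
by congr EFin; ring.
Qed.

Lemma gamma_integral_scaleE s c : 0 < s -> 0 < c ->
  gamma_integral s c = (gamma_fun s * c `^ (- s))%:E.
Proof.
by move=> s0 c0; rewrite gamma_integral_scale// gamma_integralE// -EFinM mulrC.
Qed.

(** * Rising factorials and the negative binomial series *)

Lemma rising_ge0 s n : 0 <= s -> 0 <= rising s n.
Proof. by move=> s0; apply: prodr_ge0 => i _; rewrite addr_ge0. Qed.

Lemma rising0 n : rising (0 : R) n = (n == 0%N)%:R.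
Proof.
case: n => [|n]; first by rewrite /rising big_ord0.
by rewrite /rising big_ord_recl addr0 mul0r.
Qed.

Lemma cvg_series_nneseries (u : nat -> R) (l : R) : (forall i, 0 <= u i) ->
  series u n @[n --> \oo] --> l -> (\sum_(0 <= n <oo) (u n)%:E = l%:E)%E.
Proof.
move=> u0 ul; rewrite -(cvg_lim _ ul)// -EFin_lim; last by apply/cvg_ex; exists l.
by congr (limn _); apply/funext => n; rewrite /= /series/= -sumEFin.
Qed.

Lemma expR_nneseries (y : R) : 0 <= y ->
  (\sum_(0 <= n <oo) (y ^+ n / n`!%:R)%:E = (expR y)%:E)%E.
Proof.
move=> y0; apply: cvg_series_nneseries => [i|]; first by rewrite divr_ge0 ?exprn_ge0.
exact: is_cvg_series_exp_coeff.
Qed.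

Lemma negative_binomial_series s x : 0 <= s -> 0 <= x < 1 ->
  (\sum_(0 <= n <oo) (rising s n / n`!%:R * x ^+ n)%:E = ((1 - x) `^ (- s))%:E)%E.
Proof.
move=> s_ge0 /andP[x0 x1].
have u0 n : 0 <= rising s n / n`!%:R * x ^+ n.
  by rewrite mulr_ge0 ?exprn_ge0// divr_ge0// rising_ge0.
have [s0|s_le0] := ltP 0 s; last first.
  have {s_le0} s0 : s = 0 by apply/eqP; rewrite eq_le s_le0.
  rewrite s0.
  rewrite oppr0 powRr0 nneseries_recl//; last first.
    by move=> k _; rewrite lee_fin rising0 mulr_ge0 ?exprn_ge0// divr_ge0.
  rewrite eseries0; last by move=> k k0 _; rewrite rising0 gtn_eqF// !mul0r.
  by rewrite rising0 fact0 invr1 !mul1r expr0 adde0.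
have G0 := gamma_fun_gt0 s0.
have : gamma_integral s (1 - x) =
    ((gamma_fun s)%:E * \sum_(0 <= n <oo) (rising s n / n`!%:R * x ^+ n)%:E)%E.
  rewrite /gamma_integral.
  (* expand exp(x y) in the integrand y^(s-1) exp(-y) exp(x y) *)
  transitivity (\int[mu]_y \sum_(0 <= n <oo)
      (x ^+ n / n`!%:R)%:E * (gamma_integrand (s + n%:R) 1 y)%:E)%E.
    apply: eq_integral => y _; rewrite [in LHS]/gamma_integrand; case: ifPn => y0; last first.
      by rewrite eseries0// => n _ _; rewrite /gamma_integrand (negbTE y0) mule0.
    have -> : y `^ (s - 1) * expR (- ((1 - x) * y)) =
              y `^ (s - 1) * expR (- y) * expR (x * y).
      by rewrite -mulrA -expRD; congr (_ * expR _); ring.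
    rewrite [LHS]EFinM -expR_nneseries ?mulr_ge0 ?(ltW y0)// -nneseriesZl; last first.
      by move=> n _; rewrite lee_fin divr_ge0 ?exprn_ge0 ?mulr_ge0// ltW.
    apply: eq_eseriesr => n _; rewrite -!EFinM /gamma_integrand y0; congr EFin.
    have -> : y `^ (s + n%:R - 1) = y `^ (s - 1) * y ^+ n.
      rewrite -(powR_mulrn _ (ltW y0)) -powRD; last by rewrite (gt_eqF y0) implybT.
      by congr (_ `^ _); ring.
    by rewrite mul1r exprMn; ring.
  have nn (n : nat) (y : R) : 0 <= x ^+ n / n`!%:R by rewrite divr_ge0 ?exprn_ge0.
  have mg n : measurable_fun setT (fun y => (gamma_integrand (s + n%:R) 1 y)%:E).
    by apply/measurable_EFinP; exact: measurable_gamma_integrand.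
  rewrite integral_nneseries//; last 2 first.
  - by move=> n; apply: measurable_funeM; exact: mg.
  - by move=> n y _; rewrite mule_ge0// lee_fin ?gamma_integrand_ge0 ?nn.
  rewrite -nneseriesZl; last by move=> n _; rewrite lee_fin.
  apply: eq_eseriesr => n _; rewrite ge0_integralZl//; last 3 first.
  - exact: mg.
  - by move=> y _; rewrite lee_fin gamma_integrand_ge0.
  - by rewrite lee_fin nn.
  rewrite -/(gamma_integral _ _) gamma_integralE ?ltr_wpDr// gamma_funD_nat//.
  by rewrite -!EFinM; congr EFin; ring.
rewrite gamma_integral_scaleE// ?subr_gt0// EFinM => h.
have e1 : ((gamma_fun s)^-1%:E * (gamma_fun s)%:E = 1)%E.
  by rewrite -EFinM mulVf// gt_eqF.
by rewrite -[LHS]mul1e -e1 -muleA -h muleA e1 mul1e.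
Qed.
End gamma_integrals.

(** * Independence *)

Section transfer.
Context {R : realType} {d : measure_display} {X : measurableType d}.
Import HBNNSimple.

(** The simple approximations of [f] live on [X], so the right-hand side sees the source space only
    through the weighted measures of preimages under [Y]; two different source spaces can then be
    compared term by term. *)
Let integral_weight_comp {d1} {T : measurableType d1} (mu : {measure set T -> \bar R})
    (w : T -> R) (Y : T -> X) (f : X -> \bar R) (mf : measurable_fun setT f) :
  measurable_fun setT w -> (forall x, 0 <= w x) -> measurable_fun setT Y ->
  (forall x, 0 <= f x)%E ->
  let h := nnsfun_approx measurableT mf in
  (\int[mu]_x ((w x)%:E * f (Y x)) = limn (fun n => \sum_(k \in range (h n))
     (k%:E * \int[mu]_(x in Y @^-1` (h n @^-1` [set k])) (w x)%:E)))%E.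
Proof.
move=> mw w0 mY f0 h.
have mhY n : measurable_fun setT (fun x => h n (Y x)).
  by apply: measurableT_comp => //; exact: measurable_funP.
have hmono y m n : (m <= n)%N -> h m y <= h n y.
  by move=> mn; exact/lefP/nd_nnsfun_approx.
transitivity (limn (fun n => \int[mu]_x ((w x)%:E * (h n (Y x))%:E)))%E.
  rewrite -monotone_convergence//.
  - apply: eq_integral => x _; apply/esym/cvg_lim => //.
    apply: cvgeZl => //; apply: cvg_nnsfun_approx => //.
  - by move=> n; apply/measurable_EFinP/measurable_funM.
  - by move=> n x _; rewrite -EFinM lee_fin mulr_ge0.
  - by move=> x _ m n mn; rewrite -!EFinM lee_fin ler_wpM2l// hmono.
congr (limn _); apply/funext => n.
have mpre k : measurable (Y @^-1` (h n @^-1` [set k])).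
  by rewrite -[_ @^-1` _]setTI; apply: mY => //; exact: measurable_sfunP.
transitivity (\int[mu]_x \sum_(k \in range (h n))
   (k%:E * ((w x) * \1_(Y @^-1` (h n @^-1` [set k])) x)%:E))%E.
  apply: eq_integral => x _.
  rewrite (fimfunE (h n)) -fsumEFin// ge0_mule_fsumr//; last first.
    by move=> k; rewrite EFinM; exact: nnfun_muleindic_ge0.
  apply: eq_fsbigr => k _; rewrite -!EFinM; congr EFin.
  by rewrite mulrCA.
rewrite ge0_integral_fsum//; last 2 first.
- by move=> k; apply/measurable_EFinP/measurable_funM => //; apply: measurable_funM.
- move=> k x _; rewrite [X in (_ <= _ * X)%E]EFinM muleCA mule_ge0 ?lee_fin ?w0//.
  exact: (nnfun_muleindic_ge0 (h n) k (Y x)).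
apply: eq_fsbigr => k; rewrite inE/= => -[y _ hy].
rewrite ge0_integralZl//; last 3 first.
- by apply/measurable_EFinP/measurable_funM.
- by move=> x _; rewrite lee_fin mulr_ge0.
- by rewrite lee_fin -hy.
congr (_ * _)%E; rewrite [RHS]integral_mkcond; apply: eq_integral => x _.
by rewrite patchE indicE; case: ifPn; rewrite ?mulr1 ?mulr0.
Qed.

(** The weights serve three uses: weight 1 on both sides for variables of equal law, weight 1
    against a density, and a product of independent factors against the product of their means. *)
Lemma ge0_integral_transfer {d1 d2} {T1 : measurableType d1} {T2 : measurableType d2}
    (mu1 : {measure set T1 -> \bar R}) (mu2 : {measure set T2 -> \bar R})
    (w1 : T1 -> R) (w2 : T2 -> R) (Y1 : T1 -> X) (Y2 : T2 -> X) (f : X -> \bar R) :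
  measurable_fun setT w1 -> (forall x, 0 <= w1 x) -> measurable_fun setT Y1 ->
  measurable_fun setT w2 -> (forall x, 0 <= w2 x) -> measurable_fun setT Y2 ->
  (forall U, measurable U -> \int[mu1]_(x in Y1 @^-1` U) (w1 x)%:E =
                              \int[mu2]_(x in Y2 @^-1` U) (w2 x)%:E)%E ->
  measurable_fun setT f -> (forall x, 0 <= f x)%E ->
  (\int[mu1]_x ((w1 x)%:E * f (Y1 x)) = \int[mu2]_x ((w2 x)%:E * f (Y2 x)))%E.
Proof.
move=> mw1 w10 mY1 mw2 w20 mY2 ww mf f0.
rewrite (integral_weight_comp mu1 mf)// (integral_weight_comp mu2 mf)//.
congr (limn _); apply/funext => n; apply: eq_fsbigr => k _.
by rewrite ww//; exact: measurable_sfunP.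
Qed.

End transfer.

Section independent_product.
Context {R : realType} {d : measure_display} {T : measurableType d}.
Variable P : probability T R.

Lemma integral_prod_independent (I : finType) (phi : I -> T -> R) :
  (forall i, measurable_fun setT (phi i)) ->
  (forall i x, 0 <= phi i x <= 1) ->
  (forall U : I -> set R, (forall i, measurable (U i)) ->
     P (\bigcap_i (phi i @^-1` U i)) = \prod_i P (phi i @^-1` U i))%E ->
  (\int[P]_x (\prod_i phi i x)%:E = \prod_i \int[P]_x (phi i x)%:E)%E.
Proof.
move=> mphi phi01 indep.
(* psi s is phi on s and an indicator elsewhere: by induction on s, the indicators
   of the product rule are replaced one at a time by the functions phi i. *)
pose psi (s : seq I) (U : I -> set R) i x :=
  if i \in s then phi i x else \1_(U i) (phi i x).
have mpsi s U i : (forall i, measurable (U i)) -> measurable_fun setT (psi s U i).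
  move=> mU; rewrite /psi; case: (i \in s) => //.
  by apply: measurableT_comp => //; exact: measurable_indic.
have psi01 s U i x : 0 <= psi s U i x <= 1.
  by rewrite /psi; case: ifP => // _; rewrite indicE; case: (_ \in _); rewrite ?lexx ?ler01.
have mprod s U (Q : pred I) : (forall i, measurable (U i)) ->
    measurable_fun setT (fun x => \prod_(i | Q i) psi s U i x).
  move=> mU; under eq_fun do rewrite -big_filter.
  by apply: measurable_prod => i _; exact: mpsi.
have mpre U i : (forall i, measurable (U i)) -> measurable (phi i @^-1` U i).
  by move=> mU; rewrite -[_ @^-1` _]setTI; exact: mphi.
have epsi s U i : (forall i, measurable (U i)) ->
    (0 <= \int[P]_x (psi s U i x)%:E <= 1)%E.
  move=> mU; apply/andP; split.
    by apply: integral_ge0 => x _; rewrite lee_fin; have /andP[] := psi01 s U i x.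
  apply: (@le_trans _ _ (\int[P]_x (cst 1%E) x)%E).
    apply: ge0_le_integral => //.
    - by move=> x _; rewrite lee_fin; have /andP[] := psi01 s U i x.
    - by apply/measurable_EFinP; exact: mpsi.
    - by move=> x _; rewrite lee_fin; have /andP[] := psi01 s U i x.
  by rewrite integral_cst// mul1e; exact: probability_le1.
suff key s U : (forall i, measurable (U i)) ->
    (\int[P]_x (\prod_i psi s U i x)%:E = \prod_i \int[P]_x (psi s U i x)%:E)%E.
  have := key (enum I) (fun=> setT) (fun=> measurableT).
  have psiE i x : psi (enum I) (fun=> setT) i x = phi i x by rewrite /psi mem_enum.
  under eq_integral do under eq_bigr do rewrite psiE.
  by move=> ->; apply: eq_bigr => i _; apply: eq_integral => x _; rewrite psiE.
elim: s U => [|j s IH] U mU.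
  have psiE i x : psi [::] U i x = \1_(phi i @^-1` U i) x by [].
  transitivity (P (\bigcap_i (phi i @^-1` U i))).
    rewrite -[X in P X]setIT -integral_indic//; last first.
      by apply: fin_bigcap_measurable => [|i _]; [exact: finite_finset|exact: mpre].
    apply: eq_integral => x _; congr EFin; rewrite indicE.
    have [xin|xnin] := boolP (x \in _).
      apply: big1 => i _; rewrite psiE indicE mem_set//.
      by move/set_mem : xin; apply.
    have [i xi] : exists i, ~ U i (phi i x).
      by apply/existsNP => h; move: xnin; rewrite notin_setE; apply => i _; exact: h.
    by rewrite (bigD1 i)//= psiE indicE memNset ?mul0r.
  rewrite indep//; apply: eq_bigr => i _.
  by rewrite -[X in P X]setIT -integral_indic//; exact: mpre.
have [js|js] := boolP (j \in s).
  have psiE i x : psi (j :: s) U i x = psi s U i x.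
    by rewrite /psi inE; case: eqVneq => [->|//]; rewrite js.
  under eq_integral do under eq_bigr do rewrite psiE.
  by rewrite IH//; apply: eq_bigr => i _; apply: eq_integral => x _; rewrite psiE.
have psij x : psi (j :: s) U j x = phi j x by rewrite /psi mem_head.
have psiNj i x : i != j -> psi (j :: s) U i x = psi s U i x.
  by move=> ij; rewrite /psi inE (negbTE ij).
pose c := (\prod_(i | i != j) \int[P]_x (psi s U i x)%:E)%E.
have cfin : c \is a fin_num.
  apply: prode_fin_num => i _; rewrite fin_numElt.
  have /andP[p0 p1] := epsi s U i mU.
  by rewrite (lt_le_trans _ p0)// (le_lt_trans p1)// ltry.
have c0 : (0 <= c)%E by apply: prode_ge0 => i _; have /andP[] := epsi s U i mU.
pose W x := \prod_(i | i != j) psi s U i x.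
(* The factors other than j become a weight. The absolute value provides a function of [phi j] that
   is nonnegative on all of [R], as the transfer lemma asks. *)
transitivity (\int[P]_x ((W x)%:E * `|phi j x|%:E))%E.
  apply: eq_integral => x _; rewrite -EFinM; congr EFin.
  rewrite (bigD1 j)//= psij mulrC; have /andP[h _] := phi01 j x.
  by rewrite (ger0_norm h); congr (_ * _); apply: eq_bigr => i /psiNj.
have -> : (\int[P]_x ((W x)%:E * `|phi j x|%:E) =
           \int[P]_x ((fine c)%:E * `|phi j x|%:E))%E.
  apply: (@ge0_integral_transfer _ _ _ _ _ _ _ P P W (fun=> fine c) (phi j) (phi j)
           (fun y => `|y|%:E)) => //.
  - exact: mprod.
  - by move=> x; apply: prodr_ge0 => i _; have /andP[] := psi01 s U i x.
  - by move=> x; exact: fine_ge0.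
  - move=> V mV.
    (* As j is not in s, its factor in [psi s] is still an indicator, so restricting to [phi j] in V
       amounts to choosing V as the j-th set; the induction hypothesis then applies. *)
    pose U' i := if i == j then V else U i.
    have mU' i : measurable (U' i) by rewrite /U'; case: ifP.
    have mphiV : measurable (phi j @^-1` V).
      by rewrite -[_ @^-1` _]setTI; exact: mphi.
    rewrite integral_cst// fineK//.
    transitivity (\int[P]_x (\prod_i psi s U' i x)%:E)%E.
      rewrite integral_mkcond; apply: eq_integral => x _.
      rewrite patchE (bigD1 j)//= {1}/psi (negbTE js) /U' eqxx.
      rewrite indicE; case: ifPn => xV.
        rewrite (_ : phi j x \in V); last by move: xV; rewrite !inE.
        rewrite mul1r; congr EFin; apply: eq_bigr => i ij.
        by rewrite /psi (negbTE ij).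
      rewrite (_ : phi j x \in V = false) ?mul0r//.
      by apply: contraNF xV; rewrite !inE.
    rewrite IH// (bigD1 j)//= muleC; congr (_ * _)%E.
      apply: eq_bigr => i ij; apply: eq_integral => x _.
      by rewrite /psi /U' (negbTE ij).
    rewrite -[X in P X]setIT -integral_indic//.
    by apply: eq_integral => x _; rewrite /psi (negbTE js) /U' eqxx.
  - by apply/measurable_EFinP; exact: normr_measurable.
rewrite ge0_integralZl//; last 2 first.
- by apply/measurable_EFinP; apply: measurableT_comp => //; exact: normr_measurable.
- by rewrite lee_fin fine_ge0.
rewrite fineK// muleC [RHS](bigD1 j)//=; congr (_ * _)%E.
  apply: eq_integral => x _; rewrite psij; have /andP[h _] := phi01 j x.
  by rewrite (ger0_norm h).
by apply: eq_bigr => i /psiNj h; apply: eq_integral => x _; rewrite h.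
Qed.

End independent_product.

Section freezing.
Context {R : realType} {d d1 d2 : measure_display}.
Context {T : measurableType d} {T1 : measurableType d1} {T2 : measurableType d2}.
Variable P : probability T R.

(** The product rule on rectangles identifies the law of the pair with the product of the two laws.
    The measure of E is then the integral of its sections, in which [X] stays frozen at w while [Y]
    varies. *)
Lemma independent_pair_law (X : T -> T1) (Y : T -> T2)
    (mX : measurable_fun setT X) (mY : measurable_fun setT Y) :
  (forall A B, measurable A -> measurable B ->
    P (X @^-1` A `&` Y @^-1` B) = P (X @^-1` A) * P (Y @^-1` B))%E ->
  forall E : set (T1 * T2), measurable E ->
  (P [set w | E (X w, Y w)] = \int[P]_w P [set w' | E (X w, Y w')])%E.
Proof.
move=> indep E mE.
pose Xf : {mfun T >-> T1} := HB.pack X (isMeasurableFun.Build _ _ _ _ _ mX).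
pose Yf : {mfun T >-> T2} := HB.pack Y (isMeasurableFun.Build _ _ _ _ _ mY).
have mXY : measurable_fun setT (fun w => (X w, Y w)) by exact: measurable_fun_pair.
pose XYf : {mfun T >-> (T1 * T2)%type} :=
  HB.pack (fun w => (X w, Y w)) (isMeasurableFun.Build _ _ _ _ _ mXY).
rewrite -[LHS]/(distribution P XYf E).
rewrite -(@product_measure_unique _ _ _ _ _ (distribution P Xf)
  (distribution P Yf) (distribution P XYf) _ _ mE); last first.
  by move=> A B mA mB; rewrite -indep.
rewrite /product_measure1 ge0_integral_distribution//.
  apply: eq_integral => w _; congr (P _).
  by apply/seteqP; split=> w' /=; rewrite /xsection/= inE.
exact: measurable_fun_xsection.
Qed.

Lemma measurable_independent_pair (X : T -> T1) (Y : T -> T2)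
    (mX : measurable_fun setT X) (mY : measurable_fun setT Y)
    (E : set (T1 * T2)) : measurable E ->
  measurable_fun setT (fun w => P [set w' | E (X w, Y w')]).
Proof.
move=> mE.
pose Yf : {mfun T >-> T2} := HB.pack Y (isMeasurableFun.Build _ _ _ _ _ mY).
rewrite (_ : (fun w => _) = (distribution P Yf \o xsection E) \o X).
  by apply: measurableT_comp => //; exact: measurable_fun_xsection.
apply/funext => w; congr (P _).
by apply/seteqP; split=> w' /=; rewrite /xsection/= inE.
Qed.

End freezing.

(** * Processes at random times *)

Section random_time.
Context {R : realType} {d0 d1 : measure_display}.
Context {T0 : measurableType d0} {T1 : measurableType d1}.

(** The outcome fed to [X] is a separate map [Y], so that clock and process may live on different
    spaces: [Y] is the identity when [Z i] is read at the time driven by [B], and the second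
    projection when [M i] is read at a frozen clock on a product. *)
Lemma measurable_random_time (X : R -> T0 -> R) (S : T1 -> R) (Y : T1 -> T0) :
  (forall t, 0 <= t -> measurable_fun setT (X t)) ->
  (forall w t, 0 <= t -> X s w @[s --> t^'+] --> X t w) ->
  measurable_fun setT S -> (forall x, 0 <= S x) -> measurable_fun setT Y ->
  measurable_fun setT (fun x => X (S x) (Y x)).
Proof.
move=> mX cX mS S0 mY.
(* S is rounded up strictly to a grid, so that only right continuity is needed. *)
pose rnd (N : nat) (x : R) : R := (Num.truncn (N.+1%:R * x)).+1%:R / N.+1%:R.
have rnd_gt N x : x < rnd N x.
  by rewrite /rnd ltr_pdivlMr// mulrC truncnS_gt.
have rnd_le N x : 0 <= x -> rnd N x <= x + N.+1%:R^-1.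
  move=> x0; rewrite /rnd -natr1 mulrDl mul1r lerD2r ler_pdivrMr// mulrC.
  by rewrite truncn_le// mulr_ge0.
apply: (@measurable_fun_cvg _ _ _ _ (fun N x => X (rnd N (S x)) (Y x))); last first.
  move=> x _; apply: (cvg_at_rightP (X ^~ (Y x)) (S x) _).1; first exact: cX.
  split=> [N|]; first exact: rnd_gt.
  apply: (@squeeze_cvgr _ _ _ _ (cst (S x)) (fun N => S x + N.+1%:R^-1)).
  - by apply: nearW => N; rewrite ltW ?rnd_gt//= rnd_le.
  - exact: cvg_cst.
  - rewrite -[X in _ --> X]addr0; apply: cvgD; first exact: cvg_cst.
    exact: cvg_harmonic.
move=> N _ U mU; rewrite setTI.
pose A k := [set x | k%:R / N.+1%:R <= S x < k.+1%:R / N.+1%:R].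
have mA k : measurable (A k).
  rewrite (_ : A k = S @^-1` `[k%:R / N.+1%:R, k.+1%:R / N.+1%:R[).
    by rewrite -[_ @^-1` _]setTI; apply: mS => //; exact: measurable_itv.
  by apply/seteqP; split => x; rewrite /A /= in_itv.
rewrite (_ : _ @^-1` U =
  \bigcup_k (A k `&` Y @^-1` (X (k.+1%:R / N.+1%:R) @^-1` U))); last first.
  apply/seteqP; split => [x /= xU|x [k _ []]].
    exists (Num.truncn (N.+1%:R * S x)) => //; split => //=.
    rewrite /A/= rnd_gt andbT ler_pdivrMr// mulrC truncn_le//.
    by rewrite mulr_ge0.
  rewrite /A/= ler_pdivrMr// ltr_pdivlMr// => kS; rewrite /rnd.
  by rewrite (_ : Num.truncn _ = k)//; apply/truncn_def; rewrite mulrC.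
apply: bigcup_measurable => k _; apply: measurableI => //.
rewrite -[_ @^-1` _]setTI; apply: mY => //; rewrite -[_ @^-1` _]setTI.
by apply: mX; rewrite ?divr_ge0.
Qed.

End random_time.

(** * Levy processes *)

Section levy_processes.
Context {R : realType} {d : measure_display} {T : measurableType d}.
Variable P : probability T R.
Implicit Types (X : R -> T -> R) (s h : R) (A U V : set R).

Lemma measurable_preimage_rv (Y : T -> R) A : measurable_fun setT Y -> measurable A ->
  measurable [set w | A (Y w)].
Proof. by move=> mY mA; rewrite -[X in measurable X]setTI; exact: mY. Qed.

Lemma probability_ae_eq (E F : set T) : measurable E -> measurable F ->
  {ae P, forall w, E w <-> F w} -> P E = P F.
Proof.
move=> mE mF EF; rewrite -[E]setIT -[F]setIT -!integral_indic//.
apply: ge0_ae_eq_integral => //.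
- by apply/measurable_EFinP; exact: measurable_indic.
- by apply/measurable_EFinP; exact: measurable_indic.
move: EF; apply: filterS => w EFw _; rewrite !indicE; congr (_%:R%:E).
by congr nat_of_bool; apply/idP/idP; rewrite !inE => /EFw.
Qed.

Lemma ae_probability1 (E : set T) : measurable E ->
  {ae P, forall w, E w} <-> P E = 1%E.
Proof.
move=> mE; split => [aeE|PE].
  rewrite -(@probability_setT _ _ _ P); apply: probability_ae_eq => //.
  by apply: filterS aeE.
have PC : P (~` E) = 0%E by rewrite probability_setC// PE subee.
by apply/negligibleP; [exact: measurableC|exact: PC].
Qed.

(** Carries nonnegativity (for subordinators) and integrality (for [B]) from values to
    increments. *)
Lemma levy_stationary_ae X s h A : levy_process P X -> 0 <= s -> 0 <= h -> measurable A ->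
  {ae P, forall w, A (X h w)} -> {ae P, forall w, A (X (s + h) w - X s w)}.
Proof.
move=> [mX _ _ sX _ _ _] s0 h0 mA aeA.
have mAh : measurable [set w | A (X h w)].
  by apply: measurable_preimage_rv => //; exact: mX.
have mAsh : measurable [set w | A (X (s + h) w - X s w)].
  apply: (@measurable_preimage_rv (fun w => X (s + h) w - X s w)) => //.
  by apply: measurable_funB; apply: mX; rewrite ?addr_ge0.
apply/(ae_probability1 mAsh); rewrite sX//.
exact: (ae_probability1 mAh).1 aeA.
Qed.

(** Independence of increments speaks of [X s - X 0] rather than [X s]; the two agree almost surely,
    so the rule for the former transfers to the latter. *)
Lemma levy_pair X s h U V : levy_process P X -> 0 <= s -> 0 <= h ->
  measurable U -> measurable V ->
  P ([set w | U (X s w)] `&` [set w | V (X (s + h) w - X s w)]) =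
  (P [set w | U (X s w)] * P [set w | V (X h w)])%E.
Proof.
move=> [mX X0 iX sX _ _ _] s0 h0 mU mV.
(* The grid 0, s, s + h is continued constantly so as to be nondecreasing on all of [nat]. *)
pose t (i : nat) : R := if i is i'.+1 then (if i' is _.+1 then s + h else s) else 0.
have t0 : 0 <= t 0%N by [].
have tmono : {homo t : i j / (i <= j)%N >-> i <= j}.
  apply: homo_leq => //; first exact: le_trans.
  by case=> [|[|i]] //=; rewrite lerDl.
pose E (i : 'I_2) : set T :=
  if i == 0 then [set w | U (X s w - X 0 w)] else [set w | V (X (s + h) w - X s w)].
have := iX 2%N t t0 tmono E _.
have mXs : measurable_fun setT (X s) by exact: mX.
have mX0 : measurable_fun setT (X 0) by exact: mX.
have mXsh : measurable_fun setT (X (s + h)) by apply: mX; rewrite addr_ge0.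
have mE (i : 'I_2) : (sigma_rv (fun w => X (t i.+1) w - X (t i) w)) (E i).
  case: i => [[|[|//]] i2] /=.
    by exists U => //; rewrite setTI.
  by exists V => //; rewrite setTI.
move=> /(_ mE); rewrite 2!big_ord_recl big_ord0 mule1.
rewrite (_ : \bigcap_i E i = [set w | U (X s w - X 0 w)] `&`
  [set w | V (X (s + h) w - X s w)]); last first.
  apply/seteqP; split => [w Ew|w [Ew1 Ew2] i _].
    by split; [exact: (Ew ord0)|exact: (Ew (lift ord0 ord0))].
  by rewrite /E; case: ifP.
rewrite {1}/E eqxx {1}/E/= (sX _ _ V)//.
have aeU : {ae P, forall w, [set w | U (X s w - X 0 w)] w <-> [set w | U (X s w)] w}.
  by apply: filterS X0 => w /= ->; rewrite subr0.
have mU0 : measurable [set w | U (X s w - X 0 w)].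
  apply: (@measurable_preimage_rv (fun w => X s w - X 0 w)) => //.
  exact: measurable_funB.
have mUs : measurable [set w | U (X s w)] by exact: measurable_preimage_rv.
have mVsh : measurable [set w | V (X (s + h) w - X s w)].
  apply: (@measurable_preimage_rv (fun w => X (s + h) w - X s w)) => //.
  exact: measurable_funB.
rewrite (probability_ae_eq mU0 mUs aeU) => <-.
apply: probability_ae_eq; [exact: measurableI|exact: measurableI|].
by apply: filterS aeU => w /= Uw; rewrite Uw.
Qed.


Lemma integral_one (E : set T) : measurable E ->
  (\int[P]_(w in E) (cst (1 : R) w)%:E = P E)%E.
Proof. by move=> mE; rewrite -[RHS]mul1e -integral_cst. Qed.

Lemma integral_levy_pair X s h (f g : R -> R) :
  levy_process P X -> 0 <= s -> 0 <= h ->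
  measurable_fun setT f -> measurable_fun setT g ->
  (forall x, 0 <= f x <= 1) -> (forall x, 0 <= g x <= 1) ->
  (\int[P]_w (f (X s w) * g (X (s + h) w - X s w)%R)%:E =
   (\int[P]_w (f (X s w))%:E) * (\int[P]_w (g (X h w))%:E))%E.
Proof.
move=> levyX s0 h0 mf mg f01 g01.
have mX t : 0 <= t -> measurable_fun setT (X t) by case: levyX => + *; exact.
have mXs := mX s s0; have mXh := mX h h0.
have mXsh : measurable_fun setT (X (s + h)) by apply: mX; rewrite addr_ge0.
have mD : measurable_fun setT (fun w => X (s + h) w - X s w) by exact: measurable_funB.
pose phi (b : bool) w := if b then f (X s w) else g (X (s + h) w - X s w).
transitivity (\int[P]_w (\prod_b phi b w)%:E)%E.
  by apply: eq_integral => w _; rewrite big_bool.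
rewrite (integral_prod_independent (phi := phi)); last 3 first.
- by case; apply: measurableT_comp.
- by case=> w; rewrite /phi.
- move=> U mU; rewrite big_bool/=.
  rewrite (_ : \bigcap_b _ = [set w | (f @^-1` U true) (X s w)] `&`
     [set w | (g @^-1` U false) (X (s + h) w - X s w)]); last first.
    apply/seteqP; split => [w Uw|w [? ?] [] _//].
    by split; [exact: (Uw true)|exact: (Uw false)].
  have mfU : measurable (f @^-1` U true) by rewrite -[_ @^-1` _]setTI; exact: mf.
  have mgU : measurable (g @^-1` U false) by rewrite -[_ @^-1` _]setTI; exact: mg.
  rewrite levy_pair//; congr (_ * _)%E.
  have [_ _ _ sX _ _ _] := levyX.
  by rewrite -(sX s h).
rewrite big_bool/=; congr (_ * _)%E.
transitivity (\int[P]_w ((cst 1%R w)%:E * (g (X (s + h) w - X s w))%:E))%E.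
  by apply: eq_integral => w _; rewrite mul1e.
transitivity (\int[P]_w ((cst 1%R w)%:E * (g (X h w))%:E))%E; last first.
  by apply: eq_integral => w _; rewrite mul1e.
apply: (@ge0_integral_transfer _ _ _ _ _ _ _ P P (cst 1) (cst 1)
   (fun w => X (s + h) w - X s w) (X h) (EFin \o g)) => //.
- move=> U mU; rewrite !integral_one.
  + by have [_ _ _ sX _ _ _] := levyX; exact: sX.
  + exact: measurable_preimage_rv.
  + exact: (@measurable_preimage_rv (fun w => X (s + h) w - X s w)).
- exact/measurable_EFinP.
- by move=> x; rewrite lee_fin; have /andP[] := g01 x.
Qed.

End levy_processes.

(** * One-dimensional laws *)

Section component_laws.
Context {R : realType} {d : measure_display} {T : measurableType d}.
Variable P : probability T R.
Implicit Types (s u x a theta lambda : R) (n : nat).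

Lemma subordinator_increment_ge0 (X : R -> T -> R) s (h : R) :
  subordinator P X -> 0 <= s -> 0 <= h -> {ae P, forall w, X s w <= X (s + h) w}.
Proof.
move=> [levyX X0] s0 h0.
have mpos : measurable [set x : R | 0 <= x].
  by rewrite -set_itvcy; exact: measurable_itv.
have := levy_stationary_ae levyX s0 h0 mpos (aeW _ (fun w => X0 h w h0)).
by apply: filterS => w /=; rewrite subr_ge0.
Qed.

Lemma gbinom_rising s n : gbinom (n%:R + s - 1) n = rising s n / n`!%:R.
Proof.
rewrite /gbinom /rising; congr (_ / _); rewrite (reindex_inj rev_ord_inj)/=.
by apply: eq_bigr => i _; rewrite natrB ?ltn_ord// -natr1; ring.
Qed.

(** The masses at the naturals sum to (1-theta)^s (1-theta)^(-s) = 1, so they exhaust the law. *)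
Lemma negative_binomial_integer theta (B : R -> T -> R) s :
  0 < theta < 1 -> negative_binomial_process P theta B -> 0 <= s ->
  {ae P, forall w, exists n, B s w = n%:R}.
Proof.
move=> /andP[t0 t1] [[levyB _] lawB] s0.
have mB : measurable_fun setT (B s) by case: levyB => + *; exact.
have mBn n : measurable [set w | B s w = n%:R].
  exact: (measurable_preimage_rv mB (measurable_set1 (n%:R : R))).
suff : {ae P, forall w, (\bigcup_n [set w | B s w = n%:R]) w}.
  by apply: filterS => w [n _ ?]; exists n.
apply/ae_probability1; first exact: bigcup_measurable.
rewrite measure_bigcup//; last first.
  apply/trivIsetP => i j _ _ ij; rewrite -subset0 => w [/= -> /eqP].
  by rewrite eqr_nat (negbTE ij).
rewrite (eq_eseriesl _ (Q := xpredT)); last by move=> n; rewrite in_setT.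
transitivity (((1 - theta) `^ s)%:E *
    \sum_(0 <= n <oo) (rising s n / n`!%:R * theta ^+ n)%:E)%E.
  rewrite -nneseriesZl; last first.
    move=> n _; rewrite lee_fin mulr_ge0//; last exact/exprn_ge0/ltW.
    by rewrite divr_ge0// rising_ge0.
  apply: eq_eseriesr => n _; apply: etrans (lawB s n s0) _.
  by rewrite gbinom_rising -EFinM -mulrA.
rewrite negative_binomial_series ?(ltW t0)// -EFinM -powRD; last first.
  by rewrite (gt_eqF (x := 1 - theta)) ?implybT ?subr_gt0.
by rewrite subrr powRr0.
Qed.

Section gcp_law.
Variables (k : nat) (rate : 'I_k -> R).
Hypothesis rate_gt0 : forall j, 0 < rate j.

Definition tuple_weight n (m : {ffun 'I_k -> 'I_n.+1}) : R :=
  \prod_(j < k) (rate j ^+ m j / (m j)`!%:R).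

Let L := \sum_(j < k) rate j.

(** Merging the exponentials and the powers of x lets each summand be integrated in closed form
    against a gamma density. *)
Definition gcp_pmf n x : R :=
  \sum_(m in Omega k n) tuple_weight m * (x ^+ tuple_sum m * expR (- (L * x))).

(* The law of a GCP at an independent time of distribution Gamma(s, a). *)
Definition gamma_gcp_pmf a n s : R :=
  \sum_(m in Omega k n) tuple_weight m *
    (a `^ s * (a + L) `^ (- s - (tuple_sum m)%:R) * rising s (tuple_sum m)).

Let L_ge0 : 0 <= L. Proof. by apply: sumr_ge0 => j _; exact: ltW. Qed.

Lemma tuple_weight_ge0 n (m : {ffun 'I_k -> 'I_n.+1}) : 0 <= tuple_weight m.
Proof. by apply: prodr_ge0 => j _; rewrite divr_ge0// exprn_ge0// ltW. Qed.

Lemma gcp_pmfE (M : R -> T -> R) n t : gcp P rate M -> 0 <= t ->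
  P [set w | M t w = n%:R] = (gcp_pmf n t)%:E.
Proof.
move=> [_ lawM] t0; rewrite lawM//; congr EFin; apply: eq_bigr => m _.
rewrite big_split/= -expR_sum mulrA; congr (_ * _); last first.
  by rewrite /L mulr_suml -sumrN.
rewrite /tuple_weight /tuple_sum expr_sum -big_split/=; apply: eq_bigr => j _.
by rewrite exprMn mulrAC.
Qed.

Lemma gcp_pmf_ge0 n x : 0 <= x -> 0 <= gcp_pmf n x.
Proof.
move=> x0; apply: sumr_ge0 => m _.
by rewrite mulr_ge0 ?tuple_weight_ge0// mulr_ge0 ?expR_ge0// exprn_ge0.
Qed.

Lemma gcp_pmf_le1 (M : R -> T -> R) n t : gcp P rate M -> 0 <= t -> gcp_pmf n t <= 1.
Proof.
move=> gM t0; rewrite -lee_fin -(gcp_pmfE _ gM)//.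
have [[mM _ _ _ _ _ _] _] := gM.
apply: probability_le1.
exact: (measurable_preimage_rv (mM t t0) (measurable_set1 (n%:R : R))).
Qed.

Lemma measurable_gcp_pmf n : measurable_fun setT (gcp_pmf n).
Proof.
rewrite /gcp_pmf; under eq_fun do rewrite -big_filter.
apply: measurable_sum => m; apply: measurable_funM => //.
apply: measurable_funM; first exact: measurable_funX.
by apply: measurableT_comp => //; apply: measurableT_comp => //; exact: measurable_funM.
Qed.

Lemma integral_gamma_gcp_pmf lambda a (Z : R -> T -> R) n u :
  0 < lambda -> 0 < a -> gamma_process P lambda a Z -> 0 <= u ->
  (\int[P]_w (gcp_pmf n `|Z u w|)%:E = (gamma_gcp_pmf a n (lambda * u))%:E)%E.
Proof.
move=> l0 a0 [[levyZ Z0] lawZ] u_ge0.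
have mZt t : 0 <= t -> measurable_fun setT (Z t) by case: levyZ => + *; exact.
have mZ := mZt u u_ge0.
have mpmf : measurable_fun setT (fun x => (gcp_pmf n `|x|)%:E).
  apply/measurable_EFinP; apply: measurableT_comp; first exact: measurable_gcp_pmf.
  exact: normr_measurable.
(* At u = 0 the law is a Dirac mass without density; on both sides only tuples of sum 0 contribute,
   since [rising 0] vanishes at positive indices. *)
have [u0|] := ltP 0 u; last first.
  move=> u_le0; have -> : u = 0 by apply/eqP; rewrite eq_le u_le0.
  have [_ aeZ0 _ _ _ _ _] := levyZ.
  transitivity (\int[P]_w (cst (gcp_pmf n 0)%:E w))%E.
    apply: ge0_ae_eq_integral => //.
    - by apply: (measurableT_comp mpmf); exact: mZt.
    - by move=> x _; rewrite lee_fin gcp_pmf_ge0.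
    - by move=> x _; rewrite lee_fin gcp_pmf_ge0.
    - by move: aeZ0; apply: filterS => w -> _; rewrite normr0.
  transitivity ((gcp_pmf n 0)%:E * P setT)%E; first by rewrite -integral_cst.
  rewrite probability_setT mule1 mulr0; congr EFin.
  apply: eq_bigr => m _; rewrite mulr0 oppr0 expR0 mulr1 powRr0 mul1r rising0 expr0n.
  by case: eqP => [->|]; rewrite ?oppr0 ?addr0 ?powRr0 ?mulr0 ?mulr1.
have s0 : 0 < lambda * u by rewrite mulr_gt0.
set s := lambda * u in s0 *.
have aL : 0 < a + L by rewrite ltr_wpDr.
have G0 := gamma_fun_gt0 s0.
have pdf0 x : 0 <= gamma_pdf s a x.
  rewrite /gamma_pdf; case: ifP => // _.
  by rewrite divr_ge0 ?(ltW G0)// !mulr_ge0 ?powR_ge0 ?expR_ge0.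
have pdfE x : gamma_pdf s a x = a `^ s / gamma_fun s * gamma_integrand s a x.
  by rewrite /gamma_pdf /gamma_integrand; case: ifP => _; [ring|rewrite mulr0].
have mpdf : measurable_fun setT (gamma_pdf s a).
  rewrite (_ : gamma_pdf s a = (fun x => a `^ s / gamma_fun s * gamma_integrand s a x)).
    by apply: measurable_funM => //; exact: measurable_gamma_integrand.
  by apply/funext => x; exact: pdfE.
transitivity (\int[P]_w ((cst (1 : R) w)%:E * (gcp_pmf n `|Z u w|)%:E))%E.
  by apply: eq_integral => w _; rewrite mul1e.
transitivity (\int[lebesgue_measure]_x ((gamma_pdf s a x)%:E * (gcp_pmf n `|x|)%:E))%E.
  apply: (@ge0_integral_transfer _ _ _ _ _ _ _ P lebesgue_measure (cst 1)
    (gamma_pdf s a) (Z u) id (fun x => (gcp_pmf n `|x|)%:E)) => //.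
  - move=> U mU; rewrite integral_one; first exact: lawZ.
    exact: measurable_preimage_rv.
  - by move=> x; rewrite lee_fin gcp_pmf_ge0.
(* Multiplying a gamma density by x^eta exp(- L x) shifts its shape by eta and its rate by L, up to
   a constant. The absolute value disappears because the density is 0 for x <= 0. *)
transitivity (\int[lebesgue_measure]_x \sum_(m in Omega k n)
   ((tuple_weight m * (a `^ s / gamma_fun s))%:E *
    (gamma_integrand (s + (tuple_sum m)%:R) (a + L) x)%:E))%E.
  apply: eq_integral => x _; rewrite -EFinM pdfE /gamma_integrand.
  case: ifPn => x0; last first.
    by rewrite mulr0 mul0r big1// => m _; rewrite mule0.
  rewrite /gcp_pmf mulr_sumr -sumEFin; apply: eq_bigr => m _.
  rewrite -EFinM; congr EFin; rewrite gtr0_norm//.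
  have -> : x `^ (s + (tuple_sum m)%:R - 1) = x `^ (s - 1) * x ^+ tuple_sum m.
    rewrite -(powR_mulrn _ (ltW x0)) -powRD; last by rewrite (gt_eqF x0) implybT.
    by congr (_ `^ _); ring.
  have -> : expR (- ((a + L) * x)) = expR (- (a * x)) * expR (- (L * x)).
    by rewrite -expRD; congr expR; ring.
  by ring.
have c0 (m : {ffun 'I_k -> 'I_n.+1}) : 0 <= tuple_weight m * (a `^ s / gamma_fun s).
  by rewrite mulr_ge0 ?tuple_weight_ge0// divr_ge0 ?powR_ge0// ltW.
have mgi (m : {ffun 'I_k -> 'I_n.+1}) :
    measurable_fun setT (fun x => (gamma_integrand (s + (tuple_sum m)%:R) (a + L) x)%:E).
  by apply/measurable_EFinP; exact: measurable_gamma_integrand.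
under eq_integral do rewrite -big_filter.
rewrite ge0_integral_sum//; last 2 first.
- by move=> m; apply: measurable_funeM; exact: mgi.
- by move=> m x _; rewrite mule_ge0// lee_fin ?c0 ?gamma_integrand_ge0.
rewrite big_filter /gamma_gcp_pmf -sumEFin; apply: eq_bigr => m _.
rewrite ge0_integralZl//; last 3 first.
- exact: mgi.
- by move=> x _; rewrite lee_fin gamma_integrand_ge0.
- by rewrite lee_fin c0.
rewrite -/(gamma_integral _ _) gamma_integral_scaleE ?ltr_wpDr// gamma_funD_nat//.
by rewrite -EFinM opprD; congr EFin; field; exact: lt0r_neq0.
Qed.

End gcp_law.

End component_laws.

(** * The time-changed process *)

Section sigma_process_lemmas.
Context {R : realType} {d : measure_display} {T : measurableType d}.

Lemma measurable_fun_sigma_process (X : R -> T -> R) t : 0 <= t ->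
  measurable_fun setT
    (X t : g_sigma_algebraType (\bigcup_(t in [set t : R | 0 <= t]) sigma_rv (X t)) -> R).
Proof.
move=> t0 _ U mU; apply: sub_sigma_algebra; exists t => //.
by exists U.
Qed.

Lemma sigma_process_sub (I : Type) (X : I -> R -> T -> R) i :
  sigma_process (X i) `<=` sigma_processes X.
Proof. by move=> A XA; apply: sub_sigma_algebra; exists i. Qed.

Lemma measurable_fun_sigma_processes (I : Type) (X : I -> R -> T -> R) i t : 0 <= t ->
  measurable_fun setT
    (X i t : g_sigma_algebraType (\bigcup_i sigma_process (X i)) -> R).
Proof.
move=> t0 _ U mU; apply: (@sigma_process_sub _ X i).
exact: (@measurable_fun_sigma_process (X i) t t0 measurableT U mU).
Qed.

Lemma sigma_processes_measurable (I : Type) (X : I -> R -> T -> R) :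
  (forall i t, 0 <= t -> measurable_fun setT (X i t)) ->
  sigma_processes X `<=` measurable.
Proof.
move=> mX; apply: smallest_sub; first exact: sigma_algebra_measurable.
move=> A [i _]; apply: smallest_sub; first exact: sigma_algebra_measurable.
by move=> {}A [t t0 [U mU <-]]; exact: mX.
Qed.

End sigma_process_lemmas.

Section partition.
Context {R : realType} {d : measure_display} {T : measurableType d}.
Variable P : {measure set T -> \bar R}.

Lemma ge0_integral_ae_partition (D : set T) (A : nat -> set T) (H : T -> \bar R) :
  measurable D -> (forall n, measurable (A n)) -> trivIset setT A ->
  {ae P, forall w, exists n, A n w} ->
  measurable_fun setT H -> (forall w, 0 <= H w)%E ->
  (\int[P]_(w in D) H w = \sum_(0 <= n <oo) \int[P]_(w in D `&` A n) H w)%E.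
Proof.
move=> mD mA tA aeA mH H0.
have mDA n : measurable (D `&` A n) by exact: measurableI.
have mUDA : measurable (\bigcup_n (D `&` A n)) by exact: bigcup_measurable.
rewrite -ge0_integral_bigcup//; last 2 first.
- exact: measurable_funTS.
- exact: trivIset_setIl.
rewrite [LHS]integral_mkcond [RHS]integral_mkcond.
apply: ge0_ae_eq_integral => //.
- by apply/(measurable_restrictT H mD); exact: measurable_funTS.
- by apply/(measurable_restrictT H mUDA); exact: measurable_funTS.
- by move=> w _; apply: erestrict_ge0.
- by move=> w _; apply: erestrict_ge0.
move: aeA; apply: filterS => w [n Anw] _; rewrite !patchE.
rewrite (_ : (w \in D) = (w \in \bigcup_n (D `&` A n)))//.
apply/idP/idP; rewrite !inE; first by move=> Dw; exists n.
by move=> [m _ []].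
Qed.

End partition.

Lemma big_option (I : finType) (S : Type) (idx : S) (op : Monoid.com_law idx)
    (F : option I -> S) :
  \big[op/idx]_o F o = op (F None) (\big[op/idx]_i F (Some i)).
Proof.
rewrite (bigD1 None)//=; congr (op _ _).
rewrite (reindex_omap Some id) => [|[]//].
by apply: eq_bigl => i; rewrite eqxx.
Qed.

(** * Joint law of the time-changed process at two times *)

Section time_changed_law.
Context {R : realType} {d : measure_display} {T : measurableType d}.
Variables (P : probability T R) (q : nat) (k : 'I_q -> nat).
Unset Implicit Arguments.
Variable rate : forall i : 'I_q, 'I_(k i) -> R.
Set Implicit Arguments.
Variables (lambda theta : R) (a : 'I_q -> R).
Variables (M Z : 'I_q -> R -> T -> R) (B : R -> T -> R).
Hypothesis rate_gt0 : forall i j, 0 < rate i j.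
Hypotheses (lambda_gt0 : 0 < lambda) (theta_gt0 : 0 < theta) (theta_lt1 : theta < 1).
Hypothesis a_gt0 : forall i, 0 < a i.
Hypothesis M_gcp : multivariate_gcp P rate M.
Hypothesis ZB_gamma : gamma_components P lambda theta a Z B.
Local Notation G := (gamma_subordinator lambda Z B).
Hypothesis MG_independent : independent P (sigma_processes M) (sigma_processes G).
Local Notation X := (time_changed_gcp lambda M Z B).

Implicit Types (t x : R).

Let mM i t : 0 <= t -> measurable_fun setT (M i t).
Proof. by have [Mi _] := M_gcp; case: (Mi i) => [[h _ _ _ _ _ _] _]; exact: h. Qed.

Let mZ i t : 0 <= t -> measurable_fun setT (Z i t).
Proof. by have [Zi _ _] := ZB_gamma; case: (Zi i) => [[[h _ _ _ _ _ _] _] _]; exact: h. Qed.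

Let mB t : 0 <= t -> measurable_fun setT (B t).
Proof. by have [_ [[[h _ _ _ _ _ _] _] _] _] := ZB_gamma; exact: h. Qed.

Let Z_ge0 i t w : 0 <= t -> 0 <= Z i t w.
Proof. by have [Zi _ _] := ZB_gamma; case: (Zi i) => [[_ h] _]; exact: h. Qed.

Let B_ge0 t w : 0 <= t -> 0 <= B t w.
Proof. by have [_ [[_ h] _] _] := ZB_gamma; exact: h. Qed.

Let time_ge0 t w : 0 <= t -> 0 <= t + lambda^-1 * B (lambda * t) w.
Proof.
by move=> t0; rewrite addr_ge0// mulr_ge0 ?invr_ge0 ?B_ge0 ?mulr_ge0 ?(ltW lambda_gt0).
Qed.

Let G_ge0 i t w : 0 <= t -> 0 <= G i t w.
Proof. by move=> t0; rewrite /gamma_subordinator Z_ge0// time_ge0. Qed.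

Let mG i t : 0 <= t -> measurable_fun setT (G i t).
Proof.
move=> t0; apply: (@measurable_random_time _ _ _ _ _ (Z i)
  (fun w => t + lambda^-1 * B (lambda * t) w) id) => //.
- by move=> s; exact: mZ.
- by have [Zi _ _] := ZB_gamma; case: (Zi i) => [[[_ _ _ _ _ h _] _] _]; exact: h.
- apply: measurable_funD => //; apply: measurable_funM => //.
  by apply: mB; rewrite mulr_ge0 ?(ltW lambda_gt0).
- by move=> w; exact: time_ge0.
Qed.

Definition two_states t (h : R) (n l : 'I_q -> nat) : set T :=
  in_state X t n `&` in_state X (t + h) (fun i => (n i + l i)%N).

(* The absolute value makes f bounded by 1 on all of R; its arguments will be
   almost surely nonnegative. *)
Let f i n x : R := gcp_pmf (rate i) n `|x|.

Let mf i n : measurable_fun setT (f i n).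
Proof.
apply: measurableT_comp; first exact: measurable_gcp_pmf.
exact: normr_measurable.
Qed.

Let f01 i n x : 0 <= f i n x <= 1.
Proof.
rewrite gcp_pmf_ge0 ?rate_gt0//=; have [Mi _] := M_gcp.
exact: (gcp_pmf_le1 _ (Mi i)).
Qed.

Let law_M (u v : 'I_q -> R) (n l : 'I_q -> nat) :
  (forall i, 0 <= u i <= v i) ->
  P [set w | forall i, M i (u i) w = (n i)%:R /\ M i (v i) w = (n i + l i)%:R] =
  (\prod_i (f i (n i) (u i) * f i (l i) (v i - u i))%:E)%E.
Proof.
move=> uv; have [Mi indep] := M_gcp.
pose E i := [set w | M i (u i) w = (n i)%:R /\ M i (v i) w = (n i + l i)%:R].
have u0 i : 0 <= u i by have /andP[] := uv i.
have v0 i : 0 <= v i by have /andP[h1 h2] := uv i; exact: le_trans h1 h2.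
have mE i : sigma_process (M i) (E i).
  have mMi t (t0 : 0 <= t) (c : R) :=
    @measurable_fun_sigma_process _ _ _ (M i) t t0 measurableT _ (measurable_set1 c).
  have := measurableI _ _ (mMi _ (u0 i) (n i)%:R) (mMi _ (v0 i) (n i + l i)%:R).
  by rewrite !setTI.
rewrite (_ : [set w | _] = \bigcap_i E i); last first.
  by apply/seteqP; split => [w Ew i _|w Ew i]; [exact: Ew|exact: (Ew i I)].
rewrite indep//; apply: eq_bigr => i _.
have vu : 0 <= v i - u i by rewrite subr_ge0; have /andP[] := uv i.
have [levyM _] := Mi i.
rewrite (_ : E i = [set w | [set (n i)%:R : R] (M i (u i) w)] `&`
  [set w | [set (l i)%:R : R] (M i (u i + (v i - u i)) w - M i (u i) w)]); last first.
  rewrite subrKC; apply/seteqP; split => w [/= h1 h2]; split => //=.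
    by rewrite h1 h2 natrD addrAC subrr add0r.
  by rewrite natrD -h2 h1 addrC subrK.
rewrite levy_pair// EFinM /f !ger0_norm//; congr (_ * _)%E.
  exact: (gcp_pmfE _ (Mi i)).
exact: (gcp_pmfE _ (Mi i)).
Qed.

Let integer_set : set R := [set x | exists c : nat, x = c%:R].

Let measurable_integer_set : measurable integer_set.
Proof.
rewrite (_ : integer_set = \bigcup_c [set c%:R]).
  by apply: bigcup_measurable => c _; exact: measurable_set1.
by apply/seteqP; split => x [c]; [move=> ->; exists c|move=> _ /= ->; exists c].
Qed.

Let B_integer t : 0 <= t -> {ae P, forall w, integer_set (B t w)}.
Proof.
move=> t0; have [_ NB _] := ZB_gamma.
by apply: (negative_binomial_integer _ NB) => //; rewrite theta_gt0.
Qed.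

Let B_increment_integer t (h : R) : 0 <= t -> 0 <= h ->
  {ae P, forall w, integer_set (B (t + h) w - B t w)}.
Proof.
move=> t0 h0; have [_ [[levyB _] _] _] := ZB_gamma.
exact: (levy_stationary_ae levyB t0 h0 measurable_integer_set (B_integer h0)).
Qed.

Let lt0 t : 0 <= t -> 0 <= lambda * t.
Proof. by move=> t0; rewrite mulr_ge0// ltW. Qed.

(** The deterministic value of the clock on the event [B (lambda * t) = b]. By [G_end], a further
    increment c of [B] advances it by [start h c]. *)
Let start t (b : nat) : R := t + lambda^-1 * b%:R.

Let start_ge0 t b : 0 <= t -> 0 <= start t b.
Proof. by move=> t0; rewrite addr_ge0// mulr_ge0// invr_ge0 ltW. Qed.

Let G_start i t w (b : nat) : B (lambda * t) w = b%:R -> G i t w = Z i (start t b) w.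
Proof. by rewrite /gamma_subordinator => ->. Qed.

Let G_end i t (h : R) w (b c : nat) : B (lambda * t) w = b%:R ->
  B (lambda * t + lambda * h) w - B (lambda * t) w = c%:R ->
  G i (t + h) w = Z i (start t b + start h c) w.
Proof.
rewrite /gamma_subordinator mulrDr => -> /(canRL (subrK _)) ->.
by congr (Z i _ w); rewrite /start; ring.
Qed.

(** Monotonicity of [Z i] is known almost surely only for each fixed pair of times. Almost surely
    the clock takes values in a countable set, so countably many null sets suffice. *)
Let G_nondecreasing t (h : R) : 0 <= t -> 0 <= h ->
  {ae P, forall w, forall i, G i t w <= G i (t + h) w}.
Proof.
move=> t0 h0; have [Zi _ _] := ZB_gamma.
have aeZ : {ae P, forall w, forall i b c, Z i (start t b) w <= Z i (start t b + start h c) w}.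
  apply: filter_forall => i; apply: ae_foralln => b; apply: ae_foralln => c.
  have [subZ _] := Zi i.
  exact: (subordinator_increment_ge0 subZ (start_ge0 b t0) (start_ge0 c h0)).
move: aeZ (B_integer (lt0 t0)) (B_increment_integer (lt0 t0) (lt0 h0)).
apply: filterS3 => w Zw [b Bb] [c Bc] i.
by rewrite (G_start i Bb) (G_end i Bb Bc).
Qed.

Let condition_on_G t (h : R) n l : 0 <= t -> 0 <= h ->
  P (two_states t h n l) = (\int[P]_w
    (\prod_i (f i (n i) (G i t w) * f i (l i) (G i (t + h) w - G i t w)%R))%:E)%E.
Proof.
move=> t0 h0; have th0 : 0 <= t + h by rewrite addr_ge0.
(* TG and TM are T with the sigma-algebras of G and M: the identity maps T -> TG
   and T -> TM are then independent random variables. *)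
pose TG := g_sigma_algebraType (\bigcup_i sigma_process (G i)).
pose TM := g_sigma_algebraType (\bigcup_i sigma_process (M i)).
have idG : measurable_fun setT (id : T -> TG).
  by move=> _ U mU; rewrite setTI; apply: (sigma_processes_measurable mG).
have idM : measurable_fun setT (id : T -> TM).
  by move=> _ U mU; rewrite setTI; apply: (sigma_processes_measurable mM).
pose E : set (TG * TM) := [set p | forall i,
  M i (G i t p.1) p.2 = (n i)%:R /\ M i (G i (t + h) p.1) p.2 = (n i + l i)%:R].
have mMG s i : 0 <= s -> measurable_fun setT (fun p : TG * TM => M i (G i s p.1) p.2).
  move=> s0; apply: (@measurable_random_time R _ _ TM (TG * TM)%type (M i)
    (fun p : TG * TM => G i s p.1) snd).
  - by move=> u; exact: measurable_fun_sigma_processes.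
  - by have [Mi _] := M_gcp; case: (Mi i) => [[_ _ _ _ _ c _] _]; exact: c.
  - by apply: measurableT_comp => //; exact: measurable_fun_sigma_processes.
  - by move=> p; exact: G_ge0.
  - exact: measurable_snd.
have mE : measurable E.
  rewrite (_ : E = \bigcap_i ([set p | [set (n i)%:R : R] (M i (G i t p.1) p.2)] `&`
      [set p | [set (n i + l i)%:R : R] (M i (G i (t + h) p.1) p.2)])); last first.
    apply/seteqP; split=> p Ep i; last exact: (Ep i I).
    by move=> _; exact: Ep.
  apply: fin_bigcap_measurable => [|i _]; first exact: finite_finset.
  by apply: measurableI; apply: measurable_preimage_rv => //; exact: mMG.
have ind A C : measurable A -> measurable C ->
    P ((id : T -> TG) @^-1` A `&` (id : T -> TM) @^-1` C) =
    (P ((id : T -> TG) @^-1` A) * P ((id : T -> TM) @^-1` C))%E.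
  by move=> mA mC; rewrite setIC MG_independent// muleC.
transitivity (P [set w | E (w, w)]).
  congr (P _); apply/seteqP; split => w.
    by move=> [w1 w2] i; split; [exact: w1|exact: w2].
  by move=> Ew; split => i; have [] := Ew i.
rewrite (independent_pair_law idG idM ind mE).
apply: ge0_ae_eq_integral => //.
- exact: (measurable_independent_pair P idG idM mE).
- apply/measurable_EFinP; apply: measurable_prod => i _.
  apply: measurable_funM; apply: measurableT_comp => //; first exact: mG.
  by apply: measurable_funB; exact: mG.
- move=> w _; rewrite lee_fin; apply: prodr_ge0 => i _.
  by rewrite mulr_ge0//; [have /andP[] := f01 i (n i) (G i t w)|
    have /andP[] := f01 i (l i) (G i (t + h) w - G i t w)].
move: (G_nondecreasing t0 h0); apply: filterS => w Gw _.
apply: etrans (law_M (u := fun i => G i t w) (v := fun i => G i (t + h) w) n l _) _.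
  by move=> i; rewrite Gw andbT; exact: G_ge0.
by rewrite prodEFin.
Qed.

(* The contribution of the event B (lambda * t) = b to P (in_state X t n). *)
Definition state_term t (n : 'I_q -> nat) (b : nat) : R :=
  (1 - theta) `^ (lambda * t) * (rising (lambda * t) b / b`!%:R) * theta ^+ b *
  \prod_i gamma_gcp_pmf (rate i) (a i) (n i) (lambda * t + b%:R).

Definition state_series t (n : 'I_q -> nat) : \bar R :=
  (\sum_(0 <= b <oo) (state_term t n b)%:E)%E.

Let law_B t (b : nat) : 0 <= t -> P [set w | B t w = b%:R] =
  ((1 - theta) `^ t * (rising t b / b`!%:R) * theta ^+ b)%:E.
Proof.
by move=> t0; have [_ [_ lawB] _] := ZB_gamma; rewrite lawB// gbinom_rising.
Qed.

Let lambda_start t b : lambda * start t b = lambda * t + b%:R.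
Proof. by rewrite /start mulrDr mulVKf// gt_eqF. Qed.

Let law_Z i n t b : 0 <= t ->
  (\int[P]_w (f i n (Z i (start t b) w))%:E =
   (gamma_gcp_pmf (rate i) (a i) n (lambda * t + b%:R))%:E)%E.
Proof.
move=> t0; rewrite -lambda_start; have [Zi _ _] := ZB_gamma.
have ri := @rate_gt0 i.
exact: (integral_gamma_gcp_pmf ri n lambda_gt0 (a_gt0 i) (Zi i) (start_ge0 b t0)).
Qed.

(** On this event every G_i is [Z i] at a fixed time, so the integrand is a product of q + 1
    independent factors: one per [Z i], and the indicator of the event, which depends on [B]
    alone. *)
Let law_ZB t (h : R) n l (b c : nat) : 0 <= t -> 0 <= h ->
  (\int[P]_(w in [set w | (B (lambda * t) w = b%:R)%R] `&`
      [set w | (B (lambda * t + lambda * h) w - B (lambda * t) w = c%:R)%R])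
    (\prod_i (f i (n i) (G i t w) * f i (l i) (G i (t + h) w - G i t w)%R))%:E =
  (state_term t n b * state_term h l c)%:E)%E.
Proof.
move=> t0 h0; have [Zi [[levyB _] _] indep] := ZB_gamma.
set A := _ `&` _.
have lt_ge0 := lt0 t0; have lh_ge0 := lt0 h0.
have lth_ge0 : 0 <= lambda * t + lambda * h by rewrite addr_ge0.
have s0 := start_ge0 b t0; have s0' := start_ge0 c h0.
have ss0 : 0 <= start t b + start h c by rewrite addr_ge0.
pose TB := g_sigma_algebraType (\bigcup_(t in [set t : R | 0 <= t]) sigma_rv (B t)).
(* Stated over any measurable space because the event must be measurable both for the sigma-algebra
   of [B] and for the ambient one. *)
have measurableA d' (T' : measurableType d') (B' : R -> T' -> R) :
    (forall s, 0 <= s -> measurable_fun setT (B' s)) ->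
    measurable ([set w | B' (lambda * t) w = b%:R] `&`
      [set w | B' (lambda * t + lambda * h) w - B' (lambda * t) w = c%:R]).
  move=> mB'; apply: measurableI.
    exact: (measurable_preimage_rv (mB' _ lt_ge0) (measurable_set1 _)).
  apply: (measurable_preimage_rv
    (Y := fun w => B' (lambda * t + lambda * h) w - B' (lambda * t) w)
    (A := [set c%:R])) => //.
  by apply: measurable_funB; exact: mB'.
have AB : measurable (A : set TB).
  by apply: (measurableA _ TB B) => s s_ge0; exact: measurable_fun_sigma_process.
have mA : measurable A by apply: measurableA => s; exact: mB.
pose phi (o : option 'I_q) w := if o is Some i then
  f i (n i) (Z i (start t b) w) *
  f i (l i) (Z i (start t b + start h c) w - Z i (start t b) w) else \1_A w.
transitivity (\int[P]_w (\prod_o phi o w)%:E)%E.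
  rewrite integral_mkcond; apply: eq_integral => w _; rewrite patchE big_option/= indicE.
  case: ifPn => wA; last by rewrite mul0r.
  rewrite mul1r; congr EFin; apply: eq_bigr => i _.
  have [Ab Ac] := set_mem wA.
  by rewrite (G_start i Ab) (G_end i Ab Ac).
have fg01 i x y : 0 <= f i (n i) x * f i (l i) y <= 1.
  have /andP[x0 x1] := f01 i (n i) x; have /andP[y0 y1] := f01 i (l i) y.
  by rewrite mulr_ge0// mulr_ile1.
rewrite integral_prod_independent; last 3 first.
- case=> [i|]; last exact: measurable_indic.
  apply: measurable_funM; apply: measurableT_comp => //; first exact: mZ.
  by apply: measurable_funB; exact: mZ.
- case=> [i|] w; first exact: fg01.
  by rewrite /= indicE; case: (_ \in _); rewrite ?lexx ?ler01.
- move=> U mU; apply: indep => -[i|].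
    rewrite -[_ @^-1` _]setTI.
    have mZt s (s_ge0 : 0 <= s) := measurable_fun_sigma_process (X := Z i) s_ge0.
    have : measurable_fun setT (phi (Some i) : g_sigma_algebraType
        (\bigcup_(t in [set t : R | 0 <= t]) sigma_rv (Z i t)) -> R).
      apply: measurable_funM; apply: measurableT_comp => //; first exact: mZt.
      by apply: measurable_funB; exact: mZt.
    by apply.
  rewrite -[_ @^-1` _]setTI.
  by have : measurable_fun setT (phi None : TB -> R); [exact: measurable_indic|apply].
rewrite big_option/= [X in (X * _)%E](_ : _ =
  ((1 - theta) `^ (lambda * t) * (rising (lambda * t) b / b`!%:R) * theta ^+ b *
   ((1 - theta) `^ (lambda * h) * (rising (lambda * h) c / c`!%:R) * theta ^+ c))%:E);
  last first.
  rewrite integral_indic// setIT EFinM -!law_B//.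
  exact: (levy_pair levyB lt_ge0 lh_ge0 (measurable_set1 _) (measurable_set1 _)).
rewrite (eq_bigr (fun i => (gamma_gcp_pmf (rate i) (a i) (n i) (lambda * t + b%:R) *
    gamma_gcp_pmf (rate i) (a i) (l i) (lambda * h + c%:R))%:E)); last first.
  move=> i _; have [[levyZ _] _] := Zi i.
  rewrite EFinM -!law_Z//; exact: integral_levy_pair.
by rewrite prodEFin -EFinM big_split/= /state_term; congr EFin; ring.
Qed.

(** Mean values of probabilities lie in [0, 1]. The bound by 1 lets the negative binomial series
    dominate [state_series]. *)
Let gamma_gcp_pmf01 i n t (b : nat) : 0 <= t ->
  0 <= gamma_gcp_pmf (rate i) (a i) n (lambda * t + b%:R) <= 1.
Proof.
move=> t0; rewrite -!lee_fin -law_Z//; apply/andP; split.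
  by apply: integral_ge0 => w _; rewrite lee_fin; have /andP[] := f01 i n (Z i (start t b) w).
have mZs := mZ i (start_ge0 b t0).
apply: (@le_trans _ _ (\int[P]_w (cst (1 : R) w)%:E)%E); last first.
  by rewrite integral_one// probability_setT.
apply: ge0_le_integral => //.
- by move=> w _; rewrite lee_fin; have /andP[] := f01 i n (Z i (start t b) w).
- by apply/measurable_EFinP; apply: measurableT_comp.
- by apply/measurable_EFinP; exact: measurable_cst.
- by move=> w _; rewrite lee_fin; have /andP[] := f01 i n (Z i (start t b) w).
Qed.

Lemma state_term_ge0 t n b : 0 <= t -> 0 <= state_term t n b.
Proof.
move=> t0; apply: mulr_ge0; last first.
  by apply: prodr_ge0 => i _; have /andP[] := gamma_gcp_pmf01 i (n i) b t0.
apply: mulr_ge0; last exact/exprn_ge0/ltW.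
by rewrite mulr_ge0 ?powR_ge0// divr_ge0// rising_ge0// lt0.
Qed.

Lemma state_series_fin_num t n : 0 <= t -> state_series t n \is a fin_num.
Proof.
move=> t0; have lt_ge0 := lt0 t0.
have nb_ge0 b : 0 <= rising (lambda * t) b / b`!%:R * theta ^+ b.
  by rewrite mulr_ge0 ?(exprn_ge0 _ (ltW theta_gt0))// divr_ge0// rising_ge0.
rewrite ge0_fin_numE; last by apply: nneseries_ge0 => b _ _; rewrite lee_fin state_term_ge0.
apply: (@le_lt_trans _ _ (\sum_(0 <= b <oo) (((1 - theta) `^ (lambda * t))%:E *
    (rising (lambda * t) b / b`!%:R * theta ^+ b)%:E))%E).
  apply: lee_nneseries => [b _ _|b _]; first by rewrite lee_fin state_term_ge0.
  rewrite -EFinM lee_fin /state_term -[leRHS]mulr1 !mulrA ler_wpM2l//.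
    by rewrite -!mulrA mulr_ge0 ?powR_ge0// mulrA.
  by apply: prodr_ile1 => i _; exact: gamma_gcp_pmf01.
rewrite nneseriesZl; last by move=> b _; rewrite lee_fin.
by rewrite negative_binomial_series ?(ltW theta_gt0)// -EFinM ltry.
Qed.

Lemma two_states_prob t (h : R) n l : 0 <= t -> 0 <= h ->
  P (two_states t h n l) = (state_series t n * state_series h l)%E.
Proof.
move=> t0 h0; have lt_ge0 := lt0 t0; have lh_ge0 := lt0 h0.
have lth_ge0 : 0 <= lambda * t + lambda * h by rewrite addr_ge0.
have th0 : 0 <= t + h by rewrite addr_ge0.
rewrite condition_on_G//.
set H := (fun w : T => (\prod_i _)%:E).
have mH : measurable_fun setT H.
  apply/measurable_EFinP; apply: measurable_prod => i _.
  apply: measurable_funM; apply: measurableT_comp => //; first exact: mG.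
  by apply: measurable_funB; exact: mG.
have H_ge0 w : (0 <= H w)%E.
  rewrite lee_fin; apply: prodr_ge0 => i _; apply: mulr_ge0.
    by have /andP[] := f01 i (n i) (G i t w).
  by have /andP[] := f01 i (l i) (G i (t + h) w - G i t w).
pose A (b : nat) := [set w | B (lambda * t) w = b%:R].
pose C (c : nat) := [set w | B (lambda * t + lambda * h) w - B (lambda * t) w = c%:R].
have mA b : measurable (A b).
  exact: (measurable_preimage_rv (mB lt_ge0) (measurable_set1 _)).
have mC c : measurable (C c).
  apply: (measurable_preimage_rv
    (Y := fun w => B (lambda * t + lambda * h) w - B (lambda * t) w) (A := [set c%:R])) => //.
  by apply: measurable_funB; exact: mB.
have tA : trivIset setT A.
  apply/trivIsetP => i j _ _ ij; rewrite -subset0 => w []; rewrite /A/= => -> /eqP.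
  by rewrite eqr_nat (negbTE ij).
have tC : trivIset setT C.
  apply/trivIsetP => i j _ _ ij; rewrite -subset0 => w []; rewrite /C/= => -> /eqP.
  by rewrite eqr_nat (negbTE ij).
rewrite (ge0_integral_ae_partition measurableT mA tA (B_integer lt_ge0) mH H_ge0).
transitivity (\sum_(0 <= b <oo) ((state_term t n b)%:E * state_series h l))%E.
  apply: eq_eseriesr => b _; rewrite setTI.
  rewrite (ge0_integral_ae_partition (mA b) mC tC
    (B_increment_integer lt_ge0 lh_ge0) mH H_ge0).
  rewrite /state_series -nneseriesZl; last by move=> c _; rewrite lee_fin state_term_ge0.
  by apply: eq_eseriesr => c _; rewrite -EFinM; exact: law_ZB.
rewrite -(fineK (state_series_fin_num l h0)) muleC /state_series -nneseriesZl; last first.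
  by move=> b _; rewrite lee_fin state_term_ge0.
by apply: eq_eseriesr => b _; rewrite muleC.
Qed.

End time_changed_law.

(** * The jump rate *)

Section rising_factorial.
Context {R : realType}.
Implicit Types x : R.

Lemma risingS x n : rising x n.+1 = x * rising (x + 1) n.
Proof.
rewrite /rising big_ord_recl addr0; congr (_ * _).
by apply: eq_bigr => i _; rewrite /bump/= natrD addrA.
Qed.

Lemma risingD x m n : rising x (m + n) = rising x m * rising (x + m%:R) n.
Proof.
rewrite /rising big_split_ord/=; congr (_ * _).
by apply: eq_bigr => i _; rewrite natrD addrA.
Qed.

Lemma rising_nat m n : rising (m.+1%:R : R) n * m`!%:R = (n + m)`!%:R.
Proof.
elim: n => [|n IH]; first by rewrite /rising big_ord0 mul1r add0n.
rewrite /rising big_ord_recr/= -/(rising _ n) mulrAC IH.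
by rewrite -natrD [in RHS]addSn factS natrM mulrC addSn addnC.
Qed.

Lemma cvg_rising {I : Type} {F : set_system I} {FF : Filter F} n (u : I -> R) x :
  u y @[y --> F] --> x -> rising (u y) n @[y --> F] --> rising x n.
Proof.
move=> cu; elim: n => [|n IH].
  by rewrite /rising; under eq_fun do rewrite big_ord0; rewrite big_ord0; exact: cvg_cst.
rewrite /rising; under eq_fun do rewrite big_ord_recr/=; rewrite big_ord_recr/=.
by apply: cvgM; [exact: IH|apply: cvgD; [exact: cu|exact: cvg_cst]].
Qed.

Lemma cvg_powR_exponent {I : Type} {F : set_system I} {FF : Filter F} (u : I -> R) (b x : R) :
  0 < b -> u y @[y --> F] --> x -> b `^ (u y) @[y --> F] --> b `^ x.
Proof.
move=> b0 cu; rewrite /powR gt_eqF//.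
apply: continuous_cvg; first exact: continuous_expR.
by apply: cvgM => //; exact: cvg_cst.
Qed.

End rising_factorial.

Section empty_tuples.
Context {R : realType} (k : nat) (rate : 'I_k -> R).

(** Only the zero tuple has weighted sum 0. The value is the Laplace transform of the Gamma(s, a)
    law at the total jump rate. *)
Lemma gamma_gcp_pmf0 (a s : R) :
  gamma_gcp_pmf rate a 0 s = a `^ s * (a + \sum_(j < k) rate j) `^ (- s).
Proof.
pose z : {ffun 'I_k -> 'I_1} := [ffun=> ord0].
have z0 j : z j = 0%N :> nat by rewrite ffunE.
have sum0 : tuple_sum z = 0%N by apply: big1 => j _; exact: z0.
have weight1 : tuple_weight rate z = 1.
  by apply: big1 => j _; rewrite z0 fact0 divr1.
rewrite /gamma_gcp_pmf (big_pred1 z) => [|m].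
  by rewrite sum0 weight1 mul1r subr0 /rising big_ord0 mulr1.
have -> : m = z by apply/ffunP => j; rewrite [LHS]ord1 [RHS]ord1.
by rewrite /= eqxx inE; apply/eqP; apply: big1 => j _; rewrite z0 muln0.
Qed.

(** Makes xi - 1 a true subtraction and lets a factor lambda h be split off (lambda h)_xi. *)
Lemma tuple_sum_gt0 n (m : {ffun 'I_k -> 'I_n.+1}) :
  (0 < n)%N -> m \in Omega k n -> (0 < tuple_sum m)%N.
Proof.
rewrite inE => n0 /eqP mn; rewrite lt0n; apply: contraTneq n0 => m0.
rewrite -leqNgt -mn leqn0 sum_nat_eq0; apply/forallP => j; apply/implyP => _.
move/eqP: m0; rewrite sum_nat_eq0 => /forallP/(_ j)/=.
by rewrite muln_eq0.
Qed.

End empty_tuples.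

(** * The jump intensity, and the factorisation of the terms of A *)

Section jump_rate.
Context {R : realType} (q : nat) (k : 'I_q -> nat).
Unset Implicit Arguments.
Variable rate : forall i : 'I_q, 'I_(k i) -> R.
Set Implicit Arguments.
Variables (lambda theta : R) (a : 'I_q -> R).
Hypothesis rate_gt0 : forall i j, 0 < rate i j.
Hypotheses (lambda_gt0 : 0 < lambda) (theta_gt0 : 0 < theta) (theta_lt1 : theta < 1).
Hypothesis a_gt0 : forall i, 0 < a i.
Variables (r : 'I_q) (l : nat).
Hypothesis l_gt0 : (0 < l)%N.
Implicit Types (s t h : R) (y : {ffun 'I_(k r) -> 'I_l.+1}).

Let L i := \sum_(j < k i) rate i j.
Let kappa i := a i / (a i + L i).
Let kprod := \prod_i kappa i.
Let rho := theta * kprod.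

Let L_ge0 i : 0 <= L i. Proof. by apply: sumr_ge0 => j _; exact/ltW/rate_gt0. Qed.
Let aL_gt0 i : 0 < a i + L i. Proof. by rewrite ltr_wpDr. Qed.
Let kappa_gt0 i : 0 < kappa i. Proof. by rewrite divr_gt0. Qed.
Let kappa_le1 i : kappa i <= 1. Proof. by rewrite ler_pdivrMr// mul1r lerDl. Qed.
Let kprod_gt0 : 0 < kprod. Proof. by apply: prodr_gt0 => i _. Qed.
Let kprod_le1 : kprod <= 1.
Proof. by apply: prodr_ile1 => i _; rewrite ltW//= kappa_le1. Qed.

Let rho01 : 0 <= rho < 1.
Proof.
apply/andP; split; first by rewrite mulr_ge0// ltW.
by rewrite (le_lt_trans _ theta_lt1)// ler_piMr// ltW.
Qed.

Let powR_kappa i s : kappa i `^ s = a i `^ s * (a i + L i) `^ (- s).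
Proof.
rewrite /kappa powRM ?(ltW (a_gt0 i)) ?invr_ge0 ?(ltW (aL_gt0 i))//; congr (_ * _).
by rewrite -powR_inv1 ?(ltW (aL_gt0 i))// -powRrM mulN1r.
Qed.

Let powR_kprod s : kprod `^ s = \prod_i kappa i `^ s.
Proof.
have : 0 <= kprod /\ kprod `^ s = \prod_i kappa i `^ s; last by case.
rewrite /kprod; elim/big_ind2: _ => [|x1 x2 y1 y2 [x0 <-] [y0 <-]|i _].
- by rewrite powR1.
- by rewrite mulr_ge0// powRM.
- by rewrite ltW.
Qed.

Definition single_jump (i : 'I_q) : nat := if i == r then l else 0%N.

Let coef y : R := tuple_weight (rate r) y * (a r + L r) `^ (- (tuple_sum y)%:R).

(** The intensity of jumps of size l in component r alone. It involves neither n nor t: dividing A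
    by p(n, t) removes them. *)
Definition jump_rate : R :=
  \sum_(y in Omega (k r) l)
    coef y * (lambda * (tuple_sum y - 1)`!%:R * (1 - rho) `^ (- (tuple_sum y)%:R)).

(** The part of the (h_1, h_2) term of A that depends on h_1, with c for h_1. *)
Definition jump_rate_term (c : nat) : R :=
  lambda * rho ^+ c / c`!%:R *
  \sum_(y in Omega (k r) l) coef y * (c + tuple_sum y - 1)`!%:R.

Let coef_ge0 y : 0 <= coef y.
Proof. by rewrite mulr_ge0 ?powR_ge0// tuple_weight_ge0// => j; exact: rate_gt0. Qed.

Let prod_single_jump s : \prod_i gamma_gcp_pmf (rate i) (a i) (single_jump i) s =
  kprod `^ s * \sum_(y in Omega (k r) l) coef y * rising s (tuple_sum y).
Proof.
rewrite powR_kprod !(bigD1 (P := xpredT) r)//= mulrAC; congr (_ * _); last first.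
  by apply: eq_bigr => i /negbTE ir; rewrite /single_jump ir gamma_gcp_pmf0 powR_kappa.
rewrite /single_jump eqxx mulr_sumr; apply: eq_bigr => y _.
rewrite powR_kappa /coef powRD; last by rewrite (gt_eqF (aL_gt0 r)) implybT.
by rewrite -/(L r); ring.
Qed.

Lemma single_jump_series h : 0 <= h ->
  state_series rate lambda theta a h single_jump =
  (\sum_(y in Omega (k r) l) coef y * ((1 - theta) `^ (lambda * h) *
     kprod `^ (lambda * h) * rising (lambda * h) (tuple_sum y) *
     (1 - rho) `^ (- (lambda * h + (tuple_sum y)%:R))))%:E.
Proof.
move=> h0; set x := lambda * h; have x0 : 0 <= x by rewrite mulr_ge0// ltW.
have [rho0 rho1] := andP rho01.
transitivity (\sum_(0 <= c <oo) \sum_(y in Omega (k r) l)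
   (coef y * ((1 - theta) `^ x * kprod `^ x * rising x (tuple_sum y)))%:E *
   (rising (x + (tuple_sum y)%:R) c / c`!%:R * rho ^+ c)%:E)%E.
  apply: eq_eseriesr => c _; rewrite /state_term prod_single_jump -/x.
  under [RHS]eq_bigr do rewrite -EFinM.
  rewrite sumEFin; congr EFin; rewrite mulrA mulr_sumr; apply: eq_bigr => y _.
  (* Both sides are (x)_(c + xi). The exchange takes (x)_xi out of the sum over c and leaves a
     negative binomial series of index x + xi. *)
  have hr : rising x c * rising (x + c%:R) (tuple_sum y) =
            rising x (tuple_sum y) * rising (x + (tuple_sum y)%:R) c.
    by rewrite -!risingD addnC.
  have hk : kprod `^ (x + c%:R) = kprod `^ x * kprod ^+ c.
    rewrite powRD ?powR_mulrn ?(ltW kprod_gt0)//.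
    by rewrite (gt_eqF kprod_gt0) implybT.
  rewrite hk /rho exprMn.
  transitivity (coef y * ((1 - theta) `^ x * kprod `^ x) *
    (rising x c * rising (x + c%:R) (tuple_sum y)) / c`!%:R * (theta ^+ c * kprod ^+ c)).
    by ring.
  by rewrite hr; ring.
have cc0 y : 0 <= coef y * ((1 - theta) `^ x * kprod `^ x * rising x (tuple_sum y)).
  by rewrite mulr_ge0// mulr_ge0 ?rising_ge0// mulr_ge0// powR_ge0.
have ss0 y c : 0 <= rising (x + (tuple_sum y)%:R) c / c`!%:R * rho ^+ c.
  by rewrite mulr_ge0 ?exprn_ge0// divr_ge0// rising_ge0// addr_ge0.
rewrite nneseries_sum; last by move=> y c _; rewrite mule_ge0// lee_fin.
rewrite -sumEFin; apply: eq_bigr => y _.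
rewrite nneseriesZl; last by move=> c _; rewrite lee_fin.
rewrite negative_binomial_series ?addr_ge0// -EFinM; congr EFin; ring.
Qed.

Lemma jump_rate_term_ge0 c : 0 <= jump_rate_term c.
Proof.
have [rho0 _] := andP rho01; apply: mulr_ge0; last first.
  by apply: sumr_ge0 => y _; rewrite mulr_ge0.
by rewrite divr_ge0// mulr_ge0 ?exprn_ge0// ltW.
Qed.

Lemma jump_rate_series : (\sum_(0 <= c <oo) (jump_rate_term c)%:E = jump_rate%:E)%E.
Proof.
have [rho0 rho1] := andP rho01.
transitivity (\sum_(0 <= c <oo) \sum_(y in Omega (k r) l)
   (coef y * (lambda * (tuple_sum y - 1)`!%:R))%:E *
   (rising ((tuple_sum y)%:R : R) c / c`!%:R * rho ^+ c)%:E)%E.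
  apply: eq_eseriesr => c _; rewrite /jump_rate_term.
  under [RHS]eq_bigr do rewrite -EFinM.
  rewrite sumEFin; congr EFin; rewrite mulr_sumr; apply: eq_bigr => y yl.
  have y0 := tuple_sum_gt0 l_gt0 yl.
  (* Writing (c + xi - 1)! as (xi)_c (xi - 1)! turns the sum over c into a negative binomial series
     of index xi. *)
  have -> : (c + tuple_sum y - 1)`!%:R =
      rising (tuple_sum y)%:R c * (tuple_sum y - 1)`!%:R :> R.
    by case: (tuple_sum y) y0 => // m _; rewrite addnS !subn1/= rising_nat.
  by ring.
rewrite nneseries_sum; last first.
  move=> y c _; rewrite mule_ge0// lee_fin; first by rewrite mulr_ge0// mulr_ge0// ltW.
  by rewrite mulr_ge0 ?exprn_ge0// divr_ge0// rising_ge0.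
rewrite -sumEFin; apply: eq_bigr => y _.
rewrite nneseriesZl; last first.
  by move=> c _; rewrite lee_fin mulr_ge0 ?exprn_ge0// divr_ge0// rising_ge0.
by rewrite negative_binomial_series// -EFinM; congr EFin; ring.
Qed.

(** The factor lambda h split off (lambda h)_xi cancels 1 / h. What remains is the finite sum [Phi],
    whose limit at 0 is taken factor by factor, with (1)_(xi - 1) = (xi - 1)!. *)
Lemma jump_rate_cvg :
  h^-1 * fine (state_series rate lambda theta a h single_jump) @[h --> 0^'+] --> jump_rate.
Proof.
have [rho0 rho1] := andP rho01.
pose Phi h := \sum_(y in Omega (k r) l) coef y * (lambda *
  ((1 - theta) `^ (lambda * h) * kprod `^ (lambda * h) *
   rising (lambda * h + 1) (tuple_sum y - 1) *
   (1 - rho) `^ (- (lambda * h + (tuple_sum y)%:R)))).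
apply: (@cvg_trans _ (Phi h @[h --> 0^'+])).
  apply: near_eq_cvg; near=> h.
  have h0 : 0 < h by near: h; exact: nbhs_right_gt.
  rewrite single_jump_series ?(ltW h0)//= /Phi mulr_sumr; apply: eq_bigr => y yl.
  have y0 := tuple_sum_gt0 l_gt0 yl.
  have -> : rising (lambda * h) (tuple_sum y) =
      lambda * h * rising (lambda * h + 1) (tuple_sum y - 1).
    by rewrite -risingS subn1 prednK.
  by field; exact: lt0r_neq0.
have lh0 : lambda * h @[h --> 0^'+] --> (0 : R).
  rewrite -[X in _ --> X](mulr0 lambda).
  by apply: cvgM; [exact: cvg_cst|apply: cvg_at_right_filter; exact: cvg_id].
rewrite /jump_rate; apply: cvg_big => [|y yl]; first exact: add_continuous.
apply: cvgM; first exact: cvg_cst.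
rewrite -mulrA; apply: cvgM; first exact: cvg_cst.
have -> : (tuple_sum y - 1)`!%:R = (1 - theta) `^ 0 * kprod `^ 0 *
    rising (0 + 1 : R) (tuple_sum y - 1).
  rewrite !powRr0 !mul1r add0r; have := @rising_nat R 0 (tuple_sum y - 1).
  by rewrite mulr1 addn0 => ->.
apply: cvgM; last first.
  apply: cvg_powR_exponent; first by rewrite subr_gt0.
  by apply: cvgN; rewrite -[X in _ --> X]add0r; apply: cvgD => //; exact: cvg_cst.
apply: cvgM; last by apply: cvg_rising; apply: cvgD => //; exact: cvg_cst.
by apply: cvgM; apply: cvg_powR_exponent => //; rewrite subr_gt0.
Unshelve. all: by end_near. Qed.

(** The powers of a_i and a_i + lambda_i group into kappa_i^(h_1) kappa_i^(lambda t + h_2), and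
    (lambda t)_(h_2 + eta) = (lambda t)_(h_2) (lambda t + h_2)_eta. Hence h_1 and h_2 separate, and
    h_2 plays the role of the value of [B]. *)
Lemma hazard_term_factor t (n : 'I_q -> nat) (c b : nat) :
  (1 - theta) `^ (lambda * t) * hazard_term rate lambda theta a n r l t c b =
  jump_rate_term c * state_term rate lambda theta a t n b.
Proof.
set x := lambda * t.
have kpow i (u : R) : a i `^ u * (a i + L i) `^ (- u) = kappa i `^ u by rewrite powR_kappa.
have wE i p (m : {ffun 'I_(k i) -> 'I_p.+1}) : weight rate m = tuple_weight (rate i) m by [].
have aLD i (u v : R) :
    (a i + L i) `^ (u + v) = (a i + L i) `^ u * (a i + L i) `^ v.
  by rewrite powRD// (gt_eqF (aL_gt0 i)) implybT.
(* The mixture probability of component i without its power of kappa; it depends on h_2 = b but not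
   on h_1 = c. *)
pose F i := \sum_(m in Omega (k i) (n i)) tuple_weight (rate i) m *
  ((a i + L i) `^ (- (tuple_sum m)%:R) * rising (x + b%:R) (tuple_sum m)).
have pmfE i : gamma_gcp_pmf (rate i) (a i) (n i) (x + b%:R) = kappa i `^ (x + b%:R) * F i.
  rewrite /gamma_gcp_pmf mulr_sumr; apply: eq_bigr => m _.
  by rewrite -kpow -/(L i) aLD; ring.
have otherE i : \sum_(m in Omega (k i) (n i)) weight rate m *
     (a i + total_rate rate i) `^ (- c%:R - b%:R - x - (tuple_sum m)%:R) *
     rising (b%:R + x) (tuple_sum m) = (a i + L i) `^ (- (c%:R + b%:R + x)) * F i.
  rewrite mulr_sumr; apply: eq_bigr => m _.
  have -> : - c%:R - b%:R - x - (tuple_sum m)%:R =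
    - (c%:R + b%:R + x) + - (tuple_sum m)%:R :> R by ring.
  by rewrite wE -/(L i) aLD [b%:R + x]addrC; ring.
have jumpE : \sum_(y in Omega (k r) l) \sum_(m in Omega (k r) (n r))
     weight rate y * weight rate m * (a r + total_rate rate r)
       `^ (- c%:R - b%:R - x - (tuple_sum m)%:R - (tuple_sum y)%:R) *
     (c + tuple_sum y - 1)`!%:R * rising x (b + tuple_sum m) =
   rising x b * (a r + L r) `^ (- (c%:R + b%:R + x)) * F r *
   \sum_(y in Omega (k r) l) coef y * (c + tuple_sum y - 1)`!%:R.
  rewrite mulr_sumr; apply: eq_bigr => y _.
  rewrite [F r]/F mulr_sumr mulr_suml; apply: eq_bigr => m _.
  have -> : - c%:R - b%:R - x - (tuple_sum m)%:R - (tuple_sum y)%:R =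
    - (c%:R + b%:R + x) + (- (tuple_sum m)%:R + - (tuple_sum y)%:R) :> R by ring.
  rewrite !wE -/(L r) !aLD.
  by rewrite risingD /coef; ring.
rewrite /hazard_term jumpE.
under [X in _ * (_ * X) = _]eq_bigr do rewrite otherE.
rewrite big_split/= /jump_rate_term /state_term -/x.
under [in RHS]eq_bigr do rewrite pmfE.
have apos i : a i `^ (c%:R + b%:R + x) * (a i + L i) `^ (- (c%:R + b%:R + x)) =
    kappa i ^+ c * kappa i `^ (x + b%:R).
  rewrite kpow -powR_mulrn ?(ltW (kappa_gt0 i))// -powRD; last first.
    by rewrite (gt_eqF (kappa_gt0 i)) implybT.
  by congr (_ `^ _); ring.
(* Reunites component r, which [hazard_term] treats apart, with the others, so that the powers
   recombine into kappa for every index. *)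
have prodE : (\prod_(i < q) a i `^ (c%:R + b%:R + x)) *
    ((a r + L r) `^ (- (c%:R + b%:R + x)) * F r *
     ((\prod_(i | i != r) (a i + L i) `^ (- (c%:R + b%:R + x))) * \prod_(i | i != r) F i)) =
    kprod ^+ c * \prod_i (kappa i `^ (x + b%:R) * F i).
  transitivity ((\prod_i (a i `^ (c%:R + b%:R + x) * (a i + L i) `^ (- (c%:R + b%:R + x)))) *
    \prod_i F i).
    rewrite big_split/= [\prod_i (a i + L i) `^ _](bigD1 r)//= [\prod_i F i](bigD1 r)//=.
    by ring.
  under eq_bigr do rewrite apos.
  by rewrite !big_split/= prodrXl mulrA.
transitivity ((1 - theta) `^ x * (lambda * theta ^+ (c + b) / (c`!%:R * b`!%:R)) *
   (rising x b * \sum_(y in Omega (k r) l) coef y * (c + tuple_sum y - 1)`!%:R) *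
   (kprod ^+ c * \prod_i (kappa i `^ (x + b%:R) * F i))).
  by rewrite -prodE; ring.
by rewrite /rho exprMn exprD invfM; ring.
Qed.

End jump_rate.

Lemma state_series_start {R : realType} (q : nat) (k : 'I_q -> nat)
    (rate : forall i : 'I_q, 'I_(k i) -> R) (lambda theta : R) (a : 'I_q -> R) :
  state_series rate lambda theta a 0 (fun=> 0%N) = 1%E.
Proof.
have termE b : state_term rate lambda theta a 0 (fun=> 0%N) b = (b == 0%N)%:R.
  rewrite /state_term mulr0 powRr0 mul1r rising0; case: eqP => [->|_]; last by rewrite !mul0r.
  rewrite fact0 invr1 expr0 !mul1r; apply: big1 => i _.
  by rewrite gamma_gcp_pmf0 addr0 oppr0 !powRr0 mul1r.
rewrite /state_series; under eq_eseriesr do rewrite termE.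
rewrite nneseries_recl// eseries0 ?adde0// => b b0 _.
by rewrite gtn_eqF.
Qed.

(** * The hazard rate *)

Unset Implicit Arguments.

Theorem theorem4p3 (R : realType) (d : measure_display) (T : measurableType d)
    (P : probability T R) (q : nat) (k : 'I_q -> nat)
    (rate : forall i : 'I_q, 'I_(k i) -> R)
    (lambda theta : R) (a : 'I_q -> R)
    (M Z : 'I_q -> R -> T -> R) (B : R -> T -> R)
    (k_gt0 : forall i, (0 < k i)%N)
    (rate_gt0 : forall i j, 0 < rate i j)
    (lambda_gt0 : 0 < lambda) (theta_gt0 : 0 < theta) (theta_lt1 : theta < 1)
    (a_gt0 : forall i, 0 < a i)
    (M_gcp : multivariate_gcp P rate M)
    (ZB_gamma : gamma_components P lambda theta a Z B)
    (MG_independent : independent P (sigma_processes M)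
       (sigma_processes (gamma_subordinator lambda Z B)))
    (r : 'I_q) (l : nat) (l_gt0 : (0 < l)%N) (l_le : (l <= k r)%N)
    (n : 'I_q -> nat) (t : R) (t_ge0 : 0 <= t)
    (p_gt0 : 0 < state_prob P (time_changed_gcp lambda M Z B) n t) :
  hazard_numerator rate lambda theta a n r l t \is a fin_num /\
  hazard_quotient P (time_changed_gcp lambda M Z B) n r l t h
    @[h --> 0^'+] -->
  fine (hazard_numerator rate lambda theta a n r l t)
  / state_prob P (time_changed_gcp lambda M Z B) n t.
Proof.
have X_law s h m j : 0 <= s -> 0 <= h ->
    P (two_states lambda M Z B s h m j) =
    (state_series rate lambda theta a s m * state_series rate lambda theta a h j)%E.
  exact: (two_states_prob rate_gt0 lambda_gt0 theta_gt0 theta_lt1 a_gt0 M_gcp ZB_gamma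
    MG_independent).
have fin s m : 0 <= s -> state_series rate lambda theta a s m \is a fin_num.
  exact: (state_series_fin_num rate_gt0 lambda_gt0 theta_gt0 theta_lt1 a_gt0 M_gcp ZB_gamma).
have term_ge0 m b : 0 <= state_term rate lambda theta a t m b.
  by apply: (state_term_ge0 rate_gt0 lambda_gt0 theta_gt0 a_gt0 M_gcp ZB_gamma).
have state_probE : state_prob P (time_changed_gcp lambda M Z B) n t =
    fine (state_series rate lambda theta a t n).
  rewrite /state_prob; congr fine.
  (* The one-time law is the two-time law with h = 0 and zero increments, whose second factor is
     1. *)
  rewrite -[RHS]mule1 -(state_series_start rate lambda theta a) -X_law//.
  rewrite /two_states addr0; congr (P _).
  by apply/seteqP; split => w; [move=> nw; split=> // i; rewrite addn0|case].
have numE : hazard_numerator rate lambda theta a n r l t =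
    (state_series rate lambda theta a t n * (jump_rate rate lambda theta a r l)%:E)%E.
  have pw0 : 0 < (1 - theta) `^ (lambda * t) by rewrite powR_gt0// subr_gt0.
  have rate_term_ge0 c : 0 <= jump_rate_term rate lambda theta a r l c.
    by apply: jump_rate_term_ge0.
  (* The sign is read off the factorisation after dividing by the positive (1-theta)^(lambda t); it
     allows constants to be moved through the extended-real series. *)
  have hterm_ge0 c b : 0 <= hazard_term rate lambda theta a n r l t c b.
    by rewrite -(pmulr_rge0 _ pw0) hazard_term_factor// mulr_ge0.
  rewrite /hazard_numerator -nneseriesZl; last first.
    by move=> c _; apply: nneseries_ge0 => b _ _; rewrite lee_fin.
  rewrite -(jump_rate_series rate_gt0 lambda_gt0 theta_gt0 theta_lt1 a_gt0 r l_gt0).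
  rewrite -(fineK (fin t n t_ge0)) -[RHS]nneseriesZl; last by move=> c _; rewrite lee_fin.
  apply: eq_eseriesr => c _; rewrite fineK ?fin//.
  rewrite [RHS]muleC /state_series -[RHS]nneseriesZl; last first.
    by move=> b _; rewrite lee_fin.
  rewrite -[LHS]nneseriesZl; last by move=> b _; rewrite lee_fin.
  by apply: eq_eseriesr => b _; rewrite -!EFinM hazard_term_factor.
have S_gt0 := p_gt0; rewrite state_probE in S_gt0 *.
rewrite numE; split; first by rewrite fin_numM// fin.
(* Here p(n, t) cancels, and the claimed limit becomes [jump_rate]. *)
rewrite fineM ?fin//= mulrC mulKf ?gt_eqF//.
have := jump_rate_cvg rate_gt0 lambda_gt0 theta_gt0 theta_lt1 a_gt0 l_gt0 (r := r).
apply: cvg_trans; apply: near_eq_cvg; near=> h.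
have h0 : 0 <= h by apply: ltW; near: h; exact: nbhs_right_gt.
rewrite /hazard_quotient /cond_prob -/(state_prob _ _ _ _) state_probE.
have -> : in_state (time_changed_gcp lambda M Z B) (t + h) (jump_state n r l)
    `&` in_state (time_changed_gcp lambda M Z B) t n =
    two_states lambda M Z B t h n (single_jump r l).
  rewrite setIC /two_states; congr (_ `&` in_state _ _ _).
  by apply/funext => i; rewrite /jump_state /single_jump; case: ifP; rewrite ?addn0.
rewrite X_law// fineM ?fin// mulrAC mulfV ?mul1r ?gt_eqF//.
Unshelve. all: by end_near. Qed.
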